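(* Let $X_n=\varphi\circ f^n$, $n\in\mathbb N_0$, where $\varphi$ achieves a global maximum at the repelling periodic point $\zeta$ of prime period $p$, and suppose that (R1) and (R2) hold. Let $(u_n)_{n\in\mathbb N}$ be a sequence of levels such that $\lim_{n\to\infty} n\,\mathbb P(X_0>u_n)=\tau$ for some $\tau>0$. Assume that conditions $D_p(u_n)^*$ and $D'_p(u_n)^*$ hold. Then the rare event point process $N_n$ converges in distribution, as $n\to\infty$, to a compound Poisson process $N$ with intensity $\theta$ and multiplicity distribution $\pi$ given by $$\pi(\kappa)=\theta(1-\theta)^{\kappa-1},\qquad \kappa\in\mathbb N=\{1,2,\dots\},$$ where $\theta$ is the number given in (R2).
   Context: Setting. $\mathcal X$ is a Riemannian manifold with Borel $\sigma$-algebra $\mathcal B$, $f:\mathcal X\to\mathcal X$ is measurable, $\mathbb P$ is an $f$-invariant probability measure, $\varphi:\mathcal X\to\mathbb R\cup\{\pm\infty\}$ is an observable with a global maximum at $\zeta\in\mathcal X$ ($\varphi(\zeta)=+\infty$ allowed), and $X_n=\varphi\circ f^n$. Put $u_F=\varphi(\zeta)$ and $U(u)=\{x:\varphi(x)>u\}=\{X_0>u\}$. $\zeta$ is a periodic point of prime period $p$. $a\sim b$ means that the ratio tends to $1$ (here as $u\to u_F$). (R1) For $u$ sufficiently close to $u_F$, $U(u)$ is a topological ball centred at $\zeta$; $u\mapsto\mathbb P(U(u))$ is continuous on a neighbourhood of $u_F$; moreover, for all $u$ close to $u_F$, $\{X_0>u\}\cap f^{-p}(\{X_0>u\})\ne\emptyset$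 and $\{X_0>u\}\cap f^{-j}(\{X_0>u\})=\emptyset$ for $j=1,\dots,p-1$. (R2) ($\zeta$ is repelling.) There is $0<\theta<1$ such that, for $u$ sufficiently close to $u_F$ and $i\in\mathbb N_0$, $\bigcap_{j=0}^i f^{-jp}(X_0>u)$ is another ball of smaller radius around $\zeta$ and $\mathbb P\big(\bigcap_{j=0}^i f^{-jp}(X_0>u)\big)\sim(1-\theta)^i\,\mathbb P(X_0>u)$. Annuli. $U^{(0)}(u)=U(u)$, $U^{(\kappa)}(u)=f^{-p}(U^{(\kappa-1)}(u))\cap U(u)$ for $\kappa\ge1$, and $Q^{\kappa}_{p,i}(u)=f^{-i}\big(U^{(\kappa)}(u)\setminus U^{(\kappa+1)}(u)\big)$; write $Q_{p,0}(u)=Q^0_{p,0}(u)=\{X_0>u,X_p\le u\}$. Counting. For $A\subset\mathbb R$, $\mathscr N_u(A)=\sum_{i\in A\cap\mathbb N_0}\mathbf 1_{X_i>u}$. $\mathcal S$ is the semi-ring of intervals $[a,b)$, $a,b\in\mathbb R_0^+$, and $\mathcal R$ the ring it generates (finite unions of elements of $\mathcal S$); for $J\in\mathcal R$ and a scalar $\alpha$, $\alpha J$ is the rescaled set. The rare event point process (REPP, also called EPP) is $N_n(J)=\mathscr N_{u_n}(v_nJ)$, $J\in\mathcal R$, with $v_n=1/\mathbb P(X_0>u_n)$. Condition $D_p(u_n)^*$: for any integers $t\ge 1$, $n\ge1$, $\kappa_1,\dots,\kappa_\varsigma\ge0$ and any $J=\bigcup_{j=2}^\varsigma I_j\in\mathcal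 R$ (with $I_j\in\mathcal S$) satisfying $\inf\{x:x\in J\}\ge t$, $$\Big|\mathbb P\big(Q_{p,0}^{\kappa_1}(u_n)\cap\bigcap_{j=2}^\varsigma\{\mathscr N_{u_n}(I_j)=\kappa_j\}\big)-\mathbb P\big(Q_{p,0}^{\kappa_1}(u_n)\big)\mathbb P\big(\bigcap_{j=2}^\varsigma\{\mathscr N_{u_n}(I_j)=\kappa_j\}\big)\Big|\le\gamma(n,t),$$ where for each $n$, $\gamma(n,t)$ is nonincreasing in $t$, and $n\gamma(n,t_n)\to0$ as $n\to\infty$ for some sequence $t_n=o(n)$. Condition $D'_p(u_n)^*$: there is a sequence of integers $(k_n)$ with $k_n\to\infty$ and $k_nt_n=o(n)$ ($t_n$ from $D_p(u_n)^*$) such that $\lim_{n\to\infty}n\sum_{j=1}^{[n/k_n]}\mathbb P(Q_{p,0}(u_n)\cap\{X_j>u_n\})=0$. Compound Poisson process of intensity $\theta$ and multiplicity distribution $\pi$: $N(J)=\int\mathbf 1_J\,d\big(\sum_{i\ge1}D_i\delta_{T_1+\dots+T_i}\big)$, where $(T_i)$ are i.i.d. exponential of mean $1/\theta$, $(D_i)$ are i.i.d. with distribution $\pi$ ($\pi(\kappa)=\mathbb P(D_1=\kappa)$), independent of $(T_i)$. *)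

(* Defs.v *)
From HB Require Import structures.
From mathcomp Require Import all_boot all_order all_algebra.
From mathcomp Require Import all_classical all_reals all_analysis.
From mathcomp Require Import measurable_realfun.

Set Implicit Arguments.
Unset Strict Implicit.
Unset Printing Implicit Defensive.

Import Order.TTheory GRing.Theory Num.Theory.
Import numFieldNormedType.Exports.

Local Open Scope classical_set_scope.
Local Open Scope ring_scope.

(* [h] is a homeomorphism from the subspace [A] onto the subspace [B], with
   inverse [g]; outside [A] and [B] the values of [h] and [g] are irrelevant. *)
Definition homeo_between (S T : topologicalType) (A : set S) (B : set T)
    (h : S -> T) (g : T -> S) : Prop :=
  [/\ {within A, continuous h}, {within B, continuous g},
      (forall x, A x -> B (h x) /\ g (h x) = x)
    & (forall y, B y -> A (g y) /\ h (g y) = y)].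

(* [f] is C^k on [O]; meant for open [O]. *)
Fixpoint Ck_on (R : realType) (m : nat) (W : normedModType R) (k : nat)
    (O : set 'rV[R]_m) (f : 'rV[R]_m -> W) {struct k} : Prop :=
  if k is k'.+1 then
    (forall x, O x -> differentiable f x) /\
    (forall v : 'rV[R]_m, Ck_on k' O (fun x => 'D_v f x))
  else forall x, O x -> {for x, continuous f}.

Definition smooth_on (R : realType) (m : nat) (W : normedModType R)
    (O : set 'rV[R]_m) (f : 'rV[R]_m -> W) : Prop :=
  forall k, Ck_on k O f.

(* A smooth Riemannian manifold of dimension [d] without boundary, as a smooth
   atlas together with the coordinate expression of the metric tensor in each
   chart. Tangent vectors are row vectors, so that the differential of a map
   [h] at [y] is [v |-> v *m 'J h y]. *)
Record riemannian_manifold (R : realType) (d : nat) (X : topologicalType) := {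
  chart_index : Type;
  chart_dom : chart_index -> set X;
  chart : chart_index -> X -> 'rV[R]_d;
  chart_inv : chart_index -> 'rV[R]_d -> X;
  metric : chart_index -> 'rV[R]_d -> 'M[R]_d;
  chart_overlap := fun i j => chart i @` (chart_dom i `&` chart_dom j);
  transition := fun i j (y : 'rV[R]_d) => chart j (chart_inv i y);
  manifold_hausdorff : hausdorff_space X;
  manifold_second_countable : @second_countable X;
  chart_cover : \bigcup_i chart_dom i = setT;
  chart_dom_open : forall i, open (chart_dom i);
  chart_cod_open : forall i, open (chart i @` chart_dom i);
  chart_homeo : forall i, homeo_between (chart_dom i) (chart i @` chart_dom i)
                            (chart i) (chart_inv i);
  transition_smooth : forall i j,
    smooth_on (chart_overlap i j) (transition i j);
  metric_smooth : forall i, smooth_on (chart i @` chart_dom i) (metric i);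
  metric_sym : forall i y, (chart i @` chart_dom i) y ->
    (metric i y)^T = metric i y;
  metric_posdef : forall i y, (chart i @` chart_dom i) y ->
    forall v : 'rV[R]_d, v != 0 -> 0 < (v *m metric i y *m v^T) 0 0;
  metric_compat : forall i j y, chart_overlap i j y ->
    metric i y = 'J (transition i j) y *m metric j (transition i j y)
                   *m ('J (transition i j) y)^T
}.

(* The open unit ball for the Euclidean norm (the library norm on ['rV_d] is
   the sup norm). *)
Definition euclidean_ball (R : realType) (d : nat) : set 'rV[R]_d :=
  [set v | \sum_(i < d) v 0 i ^+ 2 < 1].

(* [A] is a topological ball centred at [z]: a homeomorphic image of the open
   unit ball of R^d, with [z] the image of the origin. *)
Definition topological_ball (R : realType) (d : nat) (X : topologicalType)
    (z : X) (A : set X) : Prop :=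
  exists (h : 'rV[R]_d -> X) (g : X -> 'rV[R]_d),
    homeo_between (@euclidean_ball R d) A h g /\ h 0 = z.

Notation borel X := (g_sigma_algebraType (@open X)).

Definition prime_period (X : Type) (f : X -> X) (z : X) (p : nat) : Prop :=
  [/\ (0 < p)%N, iter p f z = z
    & forall j, (0 < j < p)%N -> iter j f z <> z].

Definition Xproc (R : realType) (X : Type) (f : X -> X) (phi : X -> \bar R)
    (j : nat) (x : X) : \bar R := phi (iter j f x).

(* Levels are extended reals, so that u_F = phi(zeta) = +oo is itself a level. *)
Definition U (R : realType) (X : Type) (phi : X -> \bar R) (u : \bar R) :
  set X := [set x | (u < phi x)%E].

Fixpoint Ukappa (R : realType) (X : Type) (f : X -> X) (phi : X -> \bar R)
    (p k : nat) (u : \bar R) {struct k} : set X :=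
  if k is k'.+1 then iter p f @^-1` (Ukappa f phi p k' u) `&` U phi u
  else U phi u.

Definition Q (R : realType) (X : Type) (f : X -> X) (phi : X -> \bar R)
    (p k i : nat) (u : \bar R) : set X :=
  iter i f @^-1` (Ukappa f phi p k u `\` Ukappa f phi p k.+1 u).

Definition nested (R : realType) (X : Type) (f : X -> X) (phi : X -> \bar R)
    (p i : nat) (u : \bar R) : set X :=
  \bigcap_(j in [set j : nat | (j <= i)%N]) (iter (j * p) f @^-1` U phi u).

(* Levels close to, and strictly below, [a]; when [a] is finite or +oo these
   are real levels. *)
Definition below (R : realType) (a : \bar R) : set_system (\bar R) :=
  within [set u | (u < a)%E] (nbhs a).

(* Here [phi z] plays the role of u_F. Continuity of u |-> P(U(u)) is required
   at every (extended) level in a neighbourhood of u_F. *)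
Definition condition_R1 (R : realType) (d : nat) (X : topologicalType)
    (P : set X -> \bar R) (f : X -> X) (phi : X -> \bar R) (z : X) (p : nat) :
    Prop :=
  [/\ \forall u \near below (phi z), @topological_ball R d X z (U phi u),
      \forall u \near phi z,
        {for u, continuous (fun v : \bar R => P (U phi v))},
      \forall u \near below (phi z),
        U phi u `&` (iter p f @^-1` U phi u) !=set0
    & \forall u \near below (phi z), forall j, (1 <= j <= p - 1)%N ->
        U phi u `&` (iter j f @^-1` U phi u) = set0].

(* A topological ball has no radius: for i >= 1 "another ball of smaller
   radius" is read as a topological ball strictly contained in U(u). *)
Definition condition_R2 (R : realType) (d : nat) (X : topologicalType)
    (P : set X -> \bar R) (f : X -> X) (phi : X -> \bar R) (z : X) (p : nat)
    (theta : R) : Prop :=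
  [/\ 0 < theta < 1,
      \forall u \near below (phi z), forall i,
        @topological_ball R d X z (nested f phi p i u) /\
        ((0 < i)%N -> nested f phi p i u `<` U phi u)
    & forall i, (fine (P (nested f phi p i u)) /
                   ((1 - theta) ^+ i * fine (P (U phi u))))
                  @[u --> below (phi z)] --> (1 : R)].

(* The number of i in A with X_i > u; it may be +oo for unbounded A. *)
Definition count_exceed (R : realType) (X : Type) (f : X -> X)
    (phi : X -> \bar R) (u : \bar R) (A : set R) (x : X) : \bar R :=
  (\sum_(i <oo | i%:R \in A) (\1_[set y | (u < Xproc f phi i y)%E] x)%:E)%E.

Definition semiringS (R : realType) : set (set R) :=
  [set I | exists a b : R, [/\ 0 <= a, 0 <= b & I = `[a, b[%classic]].

Definition ringR (R : realType) : set (set R) :=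
  [set J | exists (m : nat) (I : 'I_m -> set R),
    (forall j, semiringS (I j)) /\ J = \bigcup_j I j].

(* When P(X_0 > u_n) = 0 (possible for finitely many n only, as n P(X_0 > u_n)
   has a positive limit), 0^-1 = 0 makes the rescaling factor 0. *)
Definition REPP (R : realType) (X : Type) (P : set X -> \bar R) (f : X -> X)
    (phi : X -> \bar R) (u : nat -> R) (n : nat) (J : set R) (x : X) : \bar R :=
  let v := (fine (P (U phi (u n)%:E)))^-1 in
  count_exceed f phi (u n)%:E [set v * y | y in J] x.

(* The sequence [t] is a parameter since D'_p(u_n)^* refers to it. *)
Definition condition_Dp (R : realType) (X : Type) (P : set X -> \bar R)
    (f : X -> X) (phi : X -> \bar R) (p : nat) (u : nat -> R) (t : nat -> nat) :
    Prop :=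
  exists gamma : nat -> nat -> R,
    [/\ forall (s n k1 m : nat) (I : 'I_m -> set R) (k : 'I_m -> nat),
          (1 <= s)%N -> (1 <= n)%N -> (forall j, semiringS (I j)) ->
          lbound (\bigcup_j I j) s%:R ->
          let A := Q f phi p k1 0 (u n)%:E in
          let B := \bigcap_j [set x | count_exceed f phi (u n)%:E (I j) x
                                      = (k j)%:R%:E] in
          `|fine (P (A `&` B)) - fine (P A) * fine (P B)| <= gamma n s,
        forall n s1 s2, (1 <= s1 <= s2)%N -> gamma n s2 <= gamma n s1,
        (forall n, (1 <= t n)%N),
        (t n)%:R / n%:R @[n --> \oo] --> (0 : R)
      & n%:R * gamma n (t n) @[n --> \oo] --> (0 : R)].

Definition condition_Dp' (R : realType) (X : Type) (P : set X -> \bar R)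
    (f : X -> X) (phi : X -> \bar R) (p : nat) (u : nat -> R) (t : nat -> nat) :
    Prop :=
  exists k : nat -> nat,
    [/\ k n @[n --> \oo] --> \oo,
        (k n * t n)%:R / n%:R @[n --> \oo] --> (0 : R)
      & n%:R * (\sum_(1 <= j < (n %/ k n).+1)
           fine (P (Q f phi p 0 0 (u n)%:E `&`
                    [set x | ((u n)%:E < Xproc f phi j x)%E])))
          @[n --> \oo] --> (0 : R)].

(* Mutual independence of a sequence of random variables: the product rule
   over every finite subfamily. *)
Definition independent_seq (R : realType) (d d' : measure_display)
    (T : measurableType d) (T' : measurableType d') (P : probability T R)
    (Y : nat -> T -> T') : Prop :=
  forall (s : seq nat) (A : nat -> set T'),
    uniq s -> (forall i, measurable (A i)) ->
    P (\bigcap_(i in [set` s]) (Y i @^-1` A i)) =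
    (\prod_(i <- s) P (Y i @^-1` A i))%E.

Definition sigma_seq (d d' : measure_display) (T : measurableType d)
    (T' : measurableType d') (Y : nat -> T -> T') : set (set T) :=
  <<s \bigcup_i preimage_set_system setT (Y i) measurable >>.

Definition arrival (R : realType) (W : nat -> R) (i : nat) : R :=
  \sum_(j < i.+1) W j.

(* N(J) is the integral of 1_J against sum_i D_i delta_{W_0 + ... + W_i}, the
   sequences being indexed from 0. *)
Definition compound_poisson (R : realType) (d : measure_display)
    (T : measurableType d) (P : probability T R) (theta : R) (pi : nat -> R)
    (N : set R -> T -> \bar R) : Prop :=
  exists (W : nat -> {RV P >-> R}) (D : nat -> {RV P >-> nat}),
    [/\ independent_seq P (fun i => W i : T -> R) /\
          independent_seq P (fun i => D i : T -> nat),
        forall A B, sigma_seq (fun i => W i : T -> R) A ->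
          sigma_seq (fun i => D i : T -> nat) B ->
          P (A `&` B) = (P A * P B)%E,
        forall i (A : set R), measurable A ->
          distribution P (W i) A = exponential_prob theta A,
        forall i k, distribution P (D i) [set k] = (pi k)%:E
      & forall (J : set R) w, measurable J -> N J w =
          (\int[mseries (fun i => mscale (NngNum (ler0n R (D i w)))
                          (\d_(arrival (fun j => W j w) i))) 0]_y
             (\1_J y)%:E)%E].

Definition geometric_pmf (R : realType) (theta : R) (k : nat) : R :=
  if k is j.+1 then theta * (1 - theta) ^+ j else 0.

(* Convergence in distribution of the processes (N_n(J))_{J in ringR} : for
   all J_1, ..., J_m in the ring, (N_n(J_1), ..., N_n(J_m)) converges in
   distribution to (N(J_1), ..., N(J_m)), each N_n being defined on T and N on
   T'. The counts of bounded sets are finite (almost surely, for a compound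
   Poisson N), so [fine] only discards a null set. *)
Definition cvg_in_distribution (R : realType) (d d' : measure_display)
    (T : measurableType d) (T' : measurableType d')
    (P : probability T R) (P' : probability T' R)
    (Nn : nat -> set R -> T -> \bar R) (N : set R -> T' -> \bar R) : Prop :=
  forall (m : nat) (J : 'I_m -> set R), (forall j, ringR (J j)) ->
  forall g : 'rV[R]_m -> R, continuous g ->
    (exists M : R, forall y, `|g y| <= M) ->
    (\int[P]_x (g (\row_j fine (Nn n (J j) x)))%:E)%E @[n --> \oo] -->
    (\int[P']_w (g (\row_j fine (N (J j) w)))%:E)%E.

(* Main.v *)
(* A cluster of exceedances is read from its end: if [x] lies in the annulus
   [U^(k) \ U^(k+1)], then [X_0, X_p, ..., X_kp] exceed the level, [X_{(k+1)p}]
   does not, and by D' nothing else happens for a long time.  Together with the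
   decorrelation D this shows that the probability [X m k] of having exactly [k]
   exceedances during [m] consecutive times (and a prescribed pattern
   afterwards) satisfies, up to o(1/n), the recursion
     X (m+1) k = X m k + theta h (sum_j pi j * X m (k - j) - X m k),
   where [h = P(X_0 > u_n)], which is the discretised Kolmogorov equation of the
   compound Poisson process.  On the other side, rounding the inter-arrival
   times of [N] down to multiples of [h] gives geometric gaps, so the rounded
   process satisfies the recursion with [theta h] replaced by
   [1 - exp (- theta h)] exactly, and it converges to [N] as [h] tends to 0.
   Comparing the two recursions with the same step [h] gives the convergence of
   all joint laws on finite unions of intervals; tightness comes from Markov's
   inequality. *)
Require Import Defs.
From HB Require Import structures.
From mathcomp Require Import all_boot all_order all_algebra.
From mathcomp Require Import all_classical all_reals all_analysis.
From mathcomp Require Import measurable_realfun.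
From mathcomp Require Import ring lra zify.

Set Implicit Arguments.
Unset Strict Implicit.
Unset Printing Implicit Defensive.

Import Order.TTheory GRing.Theory Num.Theory.
Import numFieldNormedType.Exports.

Local Open Scope classical_set_scope.
Local Open Scope ring_scope.

(** As [v_n = 1/h] with [h = P(X_0 > u_n)], rescaled time advances by exactly [h] per iterate and a
    bounded window holds O(1/h) iterates, so local errors must be o(h); [n h -> tau > 0] turns the
    o(1/n) of the mixing conditions into o(h). The recursion prepends one time to a block and shifts
    by invariance of [P], so the pattern that follows enters only as the initial value at length 0.
    The obstacle is that D needs a distance between an annulus and the pattern decoupled from it.
    Hence a gap [g], longer than [t_n] and than the relevant clusters, yet eventually at most
    [n/k_n], so that D' excludes a second cluster inside it. The recursion then holds only for
    lengths at least [g]; the first [g] lengths of each block are paid for crudely, O(h) each, in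
    total O(g h) -> 0. Finitely many sets of the ring are unions of cells of a common subdivision,
    so all counts are functions of one integer vector of cell counts; convergence of its point
    probabilities together with tightness gives convergence of expectations, without Laplace
    functionals. *)

Section probability_of_sets.
Variables (R : realType) (d : measure_display) (T : measurableType d).
Variable P : probability T R.

Definition pr (A : set T) : R := fine (P A).

Lemma prE (A : set T) : measurable A -> P A = (pr A)%:E.
Proof. by move=> mA; rewrite /pr fineK// fin_num_measure. Qed.

Lemma pr_ge0 (A : set T) : 0 <= pr A.
Proof. by rewrite /pr fine_ge0. Qed.

Lemma pr_le1 (A : set T) : measurable A -> pr A <= 1.
Proof. by move=> mA; rewrite -lee_fin -prE// probability_le1. Qed.

Lemma prT : pr setT = 1.
Proof. by rewrite /pr probability_setT. Qed.

Lemma pr0 : pr set0 = 0.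
Proof. by rewrite /pr measure0. Qed.

Lemma le_pr (A B : set T) : measurable A -> measurable B -> A `<=` B ->
  pr A <= pr B.
Proof.
by move=> mA mB AB; rewrite -lee_fin -!prE// le_measure// inE.
Qed.

Lemma pr_setU (A B : set T) : measurable A -> measurable B ->
  A `&` B = set0 -> pr (A `|` B) = pr A + pr B.
Proof.
move=> mA mB AB; apply: EFin_inj.
by rewrite EFinD -!prE//; [exact: measureU | exact: measurableU].
Qed.

Lemma pr_setID (A B : set T) : measurable A -> measurable B ->
  pr A = pr (A `&` B) + pr (A `\` B).
Proof.
move=> mA mB; rewrite -pr_setU.
- by rewrite setUIDK.
- exact: measurableI.
- exact: measurableD.
- by apply/seteqP; split => x // -[[_ Bx] [_ /(_ Bx)]].
Qed.

Lemma pr_setD (A B : set T) : measurable A -> measurable B -> B `<=` A ->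
  pr (A `\` B) = pr A - pr B.
Proof.
move=> mA mB BA; rewrite (@pr_setID A B)// setIC (setIidl BA); ring.
Qed.

Lemma pr_setU_le (A B : set T) : measurable A -> measurable B ->
  pr (A `|` B) <= pr A + pr B.
Proof.
move=> mA mB; rewrite (@pr_setID _ A)//; last exact: measurableU.
rewrite (setIidr (@subsetUl _ A B)) lerD2l le_pr//.
  by apply: measurableD => //; exact: measurableU.
by move=> x [[|]].
Qed.

Lemma pr_bigcup_le (I : choiceType) (s : seq I) (A : I -> set T) :
  (forall j, measurable (A j)) ->
  pr (\bigcup_(j in [set` s]) A j) <= \sum_(j <- s) pr (A j).
Proof.
move=> mA; elim: s => [|j s IH].
  rewrite big_nil (_ : \bigcup_(_ in _) _ = set0) ?pr0//.
  by apply/seteqP; split => x // -[].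
have -> : \bigcup_(i in [set` j :: s]) A i =
    A j `|` \bigcup_(i in [set` s]) A i.
  apply/seteqP; split => x.
    move=> [i /=]; rewrite inE => /orP[/eqP-> ?|si ?]; [by left|right].
    by exists i.
  move=> [?|[i /= si ?]]; first by exists j => //=; rewrite mem_head.
  by exists i => //=; rewrite inE si orbT.
rewrite big_cons.
apply: le_trans (pr_setU_le _ _) _ => //.
  by apply: fin_bigcup_measurable => //; exact: finite_seq.
by rewrite lerD2l.
Qed.

(** Outside [C] the two events coincide, so only their parts inside [C] can differ. Exceptional
    events are discarded below in this form. *)
Lemma pr_near (A B C : set T) : measurable A -> measurable B -> measurable C ->
  (forall x, ~ C x -> (A x <-> B x)) -> `|pr A - pr B| <= pr C.
Proof.
move=> mA mB mC ABC.
have mAC := measurableI _ _ mA mC; have mBC := measurableI _ _ mB mC.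
have E : A `\` C = B `\` C.
  by apply/seteqP; split => x [Ax Cx]; split => //; apply/(ABC _ Cx).
rewrite (@pr_setID A C)// (@pr_setID B C)// E.
have := pr_ge0 (A `&` C); have := pr_ge0 (B `&` C).
have : pr (A `&` C) <= pr C by apply: le_pr => // x [].
have : pr (B `&` C) <= pr C by apply: le_pr => // x [].
rewrite ler_norml => *; apply/andP; split; lra.
Qed.

Lemma pr_fiber (A : set T) (f : T -> nat) (k : nat) :
  measurable A -> (forall j, measurable [set x | f x = j]) ->
  (forall x, A x -> (f x <= k)%N) ->
  pr A = \sum_(j < k.+1) pr (A `&` [set x | f x = j]).
Proof.
move=> mA mf.
elim: k A mA => [|k IH] A mA Ak.
  rewrite big_ord1; congr pr; apply/seteqP; split => x /=; last by case.
  by move=> Ax; split=> //; apply/eqP; rewrite -leqn0 Ak.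
rewrite big_ord_recr /= addrC (pr_setID mA (mf k.+1)); congr (_ + _).
rewrite (IH (A `\` [set x | f x = k.+1])); first last.
- by move=> x [/Ak]; rewrite leq_eqVlt => /orP[/eqP|].
- exact: measurableD.
apply: eq_bigr => j _; congr pr; apply/seteqP; split => x /= [].
  by case.
by move=> Ax fx; split => //; split => //; rewrite fx; have := ltn_ord j; lia.
Qed.

End probability_of_sets.

(** * Counts in consecutive blocks of time *)

Section block_counts.
Variables (T : Type) (xi : nat -> T -> nat).

(* [xi t x] points sit at time [t]; a block [(m, k)] of [L] occupies [m]
   consecutive times and is required to carry exactly [k] points. *)
Fixpoint block_event (s : nat) (L : seq (nat * nat)) : set T :=
  if L is (m, k) :: L' then
    [set x | \sum_(s <= t < s + m) xi t x = k]%N `&` block_event (s + m) L'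
  else setT.

Lemma block_event0 s k L x : block_event s ((0, k) :: L) x <->
  k = 0%N /\ block_event s L x.
Proof. by rewrite /= addn0 big_geq//; split => -[? ?]; split. Qed.

(** The bound on the first time is kept because [k - xi s x] is truncated: without it an overshoot
    would be read as 0 points left. *)
Lemma block_eventS s m k L x : block_event s ((m.+1, k) :: L) x <->
  (xi s x <= k)%N /\ block_event s.+1 ((m, k - xi s x)%N :: L) x.
Proof.
rewrite /= addnS -addSn big_ltn; last by rewrite addSn ltnS leq_addr.
by split=> [[<- ?]|[? [E ?]]]; (split; first by lia) => //; split => //; lia.
Qed.

(** Used with the gap as first part: once its count is known, the rest is a pattern starting beyond
    the gap. *)
Lemma block_event_cat s m m' k L x :
  block_event s ((m + m', k)%N :: L) x <->
  (\sum_(s <= t < s + m) xi t x <= k)%N /\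
  block_event (s + m) ((m', k - \sum_(s <= t < s + m) xi t x)%N :: L) x.
Proof.
rewrite /= addnA (@big_cat_nat _ _ _ (s + m)%N) ?leq_addr//=.
by split=> [[<- ?]|[? [E ?]]]; (split; first by lia) => //; split => //; lia.
Qed.

Lemma block_event_cells (s r : nat) (k kap : nat -> nat) (x : T) :
  (forall j, (j < r)%N -> (k j <= k j.+1)%N) ->
  block_event (s + k 0) (mkseq (fun j => (k j.+1 - k j, kap j)%N) r) x <->
  forall j, (j < r)%N -> (\sum_(s + k j <= t < s + k j.+1) xi t x = kap j)%N.
Proof.
elim: r s k kap => [|r IH] s k kap km; first by split.
have -> : mkseq (fun j => (k j.+1 - k j, kap j)%N) r.+1 =
    (k 1 - k 0, kap 0)%N ::
      mkseq (fun j => (k j.+2 - k j.+1, kap j.+1)%N) r.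
  by rewrite /mkseq /= (iotaDl 1) -map_comp.
rewrite /= -addnA subnKC; last exact: km.
have {}IH := IH s (fun j => k j.+1) (fun j => kap j.+1) (fun j => km j.+1).
split=> [[E0 /IH H] [|j] jr //=|H]; first exact: H.
by split; [exact: H | apply/IH => j jr; exact: H].
Qed.

End block_counts.

Lemma measurable_nat_fiber_add d (T : measurableType d) (f g : T -> nat) :
  (forall j, measurable [set x | f x = j]) ->
  (forall j, measurable [set x | g x = j]) ->
  forall j, measurable [set x | f x + g x = j]%N.
Proof.
move=> mf mg j.
(* The third factor removes [i > j], where the truncated [j - i] would admit [g x = 0]. *)
have -> : [set x | f x + g x = j]%N =
    \bigcup_i ([set x | f x = i] `&` [set x | g x = j - i]%N `&`
      (if (i <= j)%N then setT else set0)).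
  apply/seteqP; split => x /=.
    by move=> <-; exists (f x) => //; rewrite leq_addr; split => //;
      split => //=; lia.
  by move=> [i _ /= [[-> ->]]]; case: leqP => // ij _; lia.
apply: bigcup_measurable => i _; apply: measurableI; last by case: ifP.
exact: measurableI.
Qed.

Lemma measurable_nat_fiber_sum d (T : measurableType d) (xi : nat -> T -> nat) :
  (forall t j, measurable [set x | xi t x = j]) ->
  forall (I : seq nat) j, measurable [set x | \sum_(t <- I) xi t x = j]%N.
Proof.
move=> mxi; elim => [|t I IH] j.
  have [->|j0] := eqVneq j 0%N.
    rewrite (_ : mkset _ = setT)//; apply/seteqP; split => x //= _.
    by rewrite big_nil.
  rewrite (_ : mkset _ = set0)//; apply/seteqP; split => x //=.
  by rewrite big_nil => /esym/eqP; rewrite (negbTE j0).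
by under eq_set do rewrite big_cons; exact: measurable_nat_fiber_add.
Qed.

Lemma measurable_block_event d (T : measurableType d) (xi : nat -> T -> nat) :
  (forall t j, measurable [set x | xi t x = j]) ->
  forall L s, measurable (block_event xi s L).
Proof.
move=> mxi; elim => [|[m k] L IH] s //=.
by apply: measurableI => //; exact: measurable_nat_fiber_sum.
Qed.

(** * Geometric cluster sizes *)

Section geometric_weights.
Variables (R : realType) (theta : R).
Hypothesis theta01 : 0 < theta < 1.
Local Notation gpi := (geometric_pmf theta).

Lemma geometric_pmf_ge0 k : 0 <= gpi k.
Proof.
case: k => //= k; have /andP[t0 t1] := theta01.
by rewrite mulr_ge0 ?exprn_ge0 ?subr_ge0 ?ltW.
Qed.

Lemma sum_geometric_pmf n : \sum_(k < n.+1) gpi k = 1 - (1 - theta) ^+ n.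
Proof.
elim: n => [|n IH]; first by rewrite big_ord1 /= expr0 subrr.
by rewrite big_ord_recr IH /= exprS; ring.
Qed.

Lemma sum_geometric_pmf_le1 n : \sum_(k < n.+1) gpi k <= 1.
Proof.
have /andP[t0 t1] := theta01.
by rewrite sum_geometric_pmf gerBl exprn_ge0 // subr_ge0 ltW.
Qed.

(* Mass [theta (1 - theta)^j] on [j] exceedances left in the cluster, instead
   of [pi] on the whole cluster: passing from [k - 1] to [k] points produces
   the compound Poisson generator. *)
Lemma geometric_generator (X : nat -> R) (k : nat) :
  (if k is k'.+1 then
     \sum_(j < k'.+1) theta * (1 - theta) ^+ j * X (k' - j)%N else 0) -
    \sum_(j < k.+1) theta * (1 - theta) ^+ j * X (k - j)%N =
  theta * (\sum_(j < k.+1) gpi j * X (k - j)%N - X k).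
Proof.
case: k => [|k].
  by rewrite !big_ord1 /= expr0; ring.
rewrite [X in _ - X]big_ord_recl [in RHS]big_ord_recl /= expr0 mulr1 subn0.
rewrite mul0r add0r opprD addrCA -sumrB mulrBr mulr_sumr addrC; congr (_ + _).
by apply: eq_bigr => j _; rewrite /bump /= add1n subSS exprS; ring.
Qed.

End geometric_weights.

(** * The recursion of a Bernoulli process with marks, and its stability *)

Section bernoulli_renewal.
Variables (R : realType) (pi : nat -> R) (rho : R).

(** [c] is the probability of the pattern after the block; as distinct times are independent, it
    enters only as the initial value at length 0, where no point may be left over. *)
Fixpoint renewal_block (c : R) (m k : nat) : R :=
  if m is m'.+1 then
    (1 - rho) * renewal_block c m' k +
    rho * \sum_(j < k.+1) pi j * renewal_block c m' (k - j)
  else if k == 0%N then c else 0.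

(* The probability of a block pattern when each time carries, independently, a
   cluster with probability [rho], its size having distribution [pi]. *)
Definition renewal_prob (L : seq (nat * nat)) : R :=
  foldr (fun mk c => renewal_block c mk.1 mk.2) 1 L.

Hypotheses (pi_ge0 : forall k, 0 <= pi k)
  (pi_le1 : forall n, \sum_(k < n.+1) pi k <= 1) (rho01 : 0 <= rho <= 1).

(** Subprobability weights contract the sup norm; this keeps errors from being amplified along the
    recursion. *)
Lemma sum_pi_norm_le (Y : nat -> R) (b : R) k : 0 <= b ->
  (forall j, (j <= k)%N -> `|Y j| <= b) ->
  `|\sum_(j < k.+1) pi j * Y (k - j)%N| <= b.
Proof.
move=> b0 Yb; apply: le_trans (ler_norm_sum _ _ _) _.
apply: le_trans (_ : \sum_(j < k.+1) pi j * b <= _).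
  apply: ler_sum => j _; rewrite normrM ger0_norm// ler_wpM2l// Yb//.
  by rewrite leq_subr.
by rewrite -mulr_suml ler_piMl.
Qed.

Lemma renewal_block01 c m k : 0 <= c <= 1 -> 0 <= renewal_block c m k <= 1.
Proof.
move=> c01; elim: m k => [|m IH] k /=; first by case: ifP => _ //;
  rewrite lexx ler01.
have /andP[r0 r1] := rho01.
have B : 0 <= \sum_(j < k.+1) pi j * renewal_block c m (k - j) <= 1.
  rewrite sumr_ge0/=; last first.
    by move=> j _; rewrite mulr_ge0//; case/andP: (IH (k - j)%N).
  apply: le_trans (ler_norm _) _; apply: sum_pi_norm_le => // j _.
  by case/andP: (IH j) => ? ?; rewrite ger0_norm.
move: (IH k) B; set S := \sum_(j < _) _; set y := renewal_block _ _ _.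
move=> /andP[y0 y1] /andP[S0 S1].
by apply/andP; split; nra.
Qed.

(* Stability of the discretised Kolmogorov equation of the compound Poisson
   process: local errors add up. *)
Lemma renewal_block_approx (X : nat -> nat -> R) (err : nat -> R)
    (c c' delta a : R) (K M : nat) :
  0 <= c' <= 1 -> 0 <= a <= 1 -> (forall m, 0 <= err m) -> `|c - c'| <= delta ->
  (forall k, X 0%N k = if k == 0%N then c else 0) ->
  (forall m k, (m < M)%N -> (k <= K)%N ->
    `|X m.+1 k - X m k - a * (\sum_(j < k.+1) pi j * X m (k - j)%N - X m k)|
      <= err m) ->
  forall m k, (m <= M)%N -> (k <= K)%N ->
  `|X m k - renewal_block c' m k| <=
    delta + \sum_(i < m) (err i + `|rho - a|).
Proof.
move=> c01 /andP[a0 a1] err0 cc' X0 XS; have d0 := le_trans (normr_ge0 _) cc'.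
elim=> [|m IH] k mM kK.
  by rewrite big_ord0 addr0 X0 /=; case: ifP => _ //; rewrite subrr normr0.
have {}IH k' : (k' <= K)%N -> _ := IH k' (ltnW mM).
rewrite big_ord_recr /=; set b := delta + _ in IH *.
rewrite -/renewal_block addrA -/b.
set S := \sum_(j < _) _ * renewal_block _ _ _.
set y := renewal_block c' m k.
set Z := \sum_(j < k.+1) pi j * X m (k - j)%N.
have b0 : 0 <= b.
  by rewrite addr_ge0// sumr_ge0// => i _; rewrite addr_ge0.
have ZS : `|Z - S| <= b.
  rewrite -sumrB; under eq_bigr do rewrite -mulrBr.
  apply: (sum_pi_norm_le (Y := fun j => X m j - renewal_block c' m j)) => //.
  by move=> j jk; apply: IH; exact: leq_trans jk kK.
have Sy : `|S - y| <= 1.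
  have /andP[y0 y1] : 0 <= y <= 1 by exact: renewal_block01.
  have S0 : 0 <= S.
    rewrite sumr_ge0// => j _; rewrite mulr_ge0//.
    by have /andP[] := renewal_block01 m (k - j) c01.
  have S1 : S <= 1.
    apply: le_trans (ler_norm _) _; apply: sum_pi_norm_le => // j _.
    by have /andP[? ?] := renewal_block01 m j c01; rewrite ger0_norm.
  by rewrite ler_norml; apply/andP; split; lra.
(* The earlier errors [X m k - y] and [Z - S] carry the weights [1 - a] and [a], so together they
   stay below [b]; new are the local error and [rho - a], multiplied by a quantity of modulus at
   most 1. *)
have -> : X m.+1 k - ((1 - rho) * y + rho * S) =
  (X m.+1 k - X m k - a * (Z - X m k)) + (1 - a) * (X m k - y) + a * (Z - S)
    - (rho - a) * (S - y) by ring.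
have := XS m k mM kK; rewrite -/Z => E.
have := IH k kK; rewrite -/y => Xy.
apply: le_trans (ler_normB _ _) _.
rewrite [leRHS](_ : _ = err m + (1 - a) * b + a * b + `|rho - a| * 1);
  last ring.
apply: lerD; last by rewrite normrM ler_wpM2l.
apply: le_trans (ler_normD _ _) _; apply: lerD; last first.
  by rewrite normrM ger0_norm// ler_wpM2l.
apply: le_trans (ler_normD _ _) _; apply: lerD => //.
by rewrite normrM ger0_norm ?subr_ge0// ler_wpM2l// subr_ge0.
Qed.

Lemma renewal_prob01 L : 0 <= renewal_prob L <= 1.
Proof.
elim: L => [|[m k] L IH] /=; first by rewrite ler01 lexx.
exact: renewal_block01.
Qed.

End bernoulli_renewal.

(** * The exceedance process satisfies the recursion up to explicit errors *)

Section exceedances.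
Variables (R : realType) (d : measure_display) (T : measurableType d).
Variables (P : probability T R) (f : T -> T) (phi : T -> \bar R) (p : nat).
Variable u : \bar R.
Hypotheses (mf : measurable_fun setT f) (mphi : measurable_fun setT phi).
Hypothesis Pinv : forall A, measurable A -> P (f @^-1` A) = P A.

Definition exceed (t : nat) (x : T) : nat := (u < Xproc f phi t x)%E.

Local Notation Ek := (block_event exceed).
Local Notation h := (pr P (U phi u)).

Lemma measurable_iter i : measurable_fun setT (iter i f).
Proof.
elim: i => [|i IH]; first exact: measurable_id.
exact: (measurableT_comp mf IH).
Qed.

Lemma measurable_preimage_iter i A : measurable A ->
  measurable (iter i f @^-1` A).
Proof. by move=> mA; rewrite -[X in measurable X]setTI;
  exact: (measurable_iter i measurableT mA). Qed.

Lemma pr_preimage_iter i A : measurable A -> pr P (iter i f @^-1` A) = pr P A.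
Proof.
move=> mA; elim: i => //= i <-; rewrite /pr; congr fine.
rewrite -(Pinv (measurable_preimage_iter i mA)); congr (P _).
by apply/seteqP; split => x /=; rewrite -iterS iterSr.
Qed.

Lemma measurable_U : measurable (U phi u).
Proof.
by have := emeasurable_fun_o_infty measurableT mphi u; rewrite setTI.
Qed.

Lemma measurable_exceed t j : measurable [set x | exceed t x = j].
Proof.
have mU := measurable_preimage_iter t measurable_U.
case: j => [|[|j]].
- rewrite (_ : mkset _ = ~` (iter t f @^-1` U phi u)); first exact: measurableC.
  by apply/seteqP; split => x /=; rewrite /exceed /Xproc /U /=; case: (u < _)%E.
- rewrite (_ : mkset _ = iter t f @^-1` U phi u)//.
  by apply/seteqP; split => x /=; rewrite /exceed /Xproc /U /=; case: (u < _)%E.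
- rewrite (_ : mkset _ = set0)//.
  by apply/seteqP; split => x //=; rewrite /exceed; case: (u < _)%E.
Qed.

Lemma measurable_Ek s L : measurable (Ek s L).
Proof. by apply: measurable_block_event; exact: measurable_exceed. Qed.

Lemma exceedD t i x : exceed (t + i) x = exceed t (iter i f x).
Proof. by rewrite /exceed /Xproc iterD. Qed.

Lemma exceedE t x : U phi u (iter t f x) <-> exceed t x = 1%N.
Proof. by rewrite /exceed /U /Xproc /=; case: (u < _)%E; split. Qed.

Lemma exceedN t x : ~ U phi u (iter t f x) <-> exceed t x = 0%N.
Proof. by rewrite /exceed /U /Xproc /=; case: (u < _)%E; split. Qed.

Lemma block_event_iter i s L x : Ek (s + i) L x <-> Ek s L (iter i f x).
Proof.
elim: L s => [|[m k] L IH] s //=.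
have -> : (\sum_(s + i <= t < s + i + m) exceed t x =
           \sum_(s <= t < s + m) exceed t (iter i f x))%N.
  by rewrite big_addn addnAC addnK; apply: eq_bigr => t _; rewrite exceedD.
by rewrite addnAC IH.
Qed.

(** Stationarity: a pattern may be started at any time, which is what allows a block to be
    lengthened at its front. *)
Lemma pr_block_event s L : pr P (Ek s L) = pr P (Ek 0 L).
Proof.
rewrite -(pr_preimage_iter s (measurable_Ek 0 L)); congr pr.
by apply/seteqP; split => x /=; rewrite -block_event_iter add0n.
Qed.

Lemma UkappaP k x : Ukappa f phi p k u x <->
  forall j, (j <= k)%N -> U phi u (iter (j * p) f x).
Proof.
elim: k x => [|k IH] x /=.
  by split=> [Ux j|/(_ 0%N)]; [rewrite leqn0 => /eqP->|exact].
split=> [[/IH H Ux] [|j] jk //|H]; last split.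
- by rewrite mulSn addnC iterD; exact: (H j).
- by apply/IH => j jk; rewrite -iterD addnC -mulSn; exact: H.
- exact: (H 0%N).
Qed.

Lemma measurable_Ukappa k : measurable (Ukappa f phi p k u).
Proof.
elim: k => [|k IH] /=; first exact: measurable_U.
by apply: measurableI; [exact: measurable_preimage_iter|exact: measurable_U].
Qed.

Lemma subset_Ukappa k : Ukappa f phi p k.+1 u `<=` Ukappa f phi p k u.
Proof. by move=> x /UkappaP H; apply/UkappaP => j jk; exact/H/leqW. Qed.

Lemma measurable_Q k : measurable (Q f phi p k 0 u).
Proof.
exact: measurableD (measurable_Ukappa k) (measurable_Ukappa k.+1).
Qed.

Lemma pr_Q k : pr P (Q f phi p k 0 u) =
  pr P (Ukappa f phi p k u) - pr P (Ukappa f phi p k.+1 u).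
Proof. exact: pr_setD (measurable_Ukappa k) (measurable_Ukappa k.+1)
  (@subset_Ukappa k). Qed.

Lemma pr_U_split k A : measurable A -> pr P (U phi u `&` A) =
  \sum_(j < k) pr P (Q f phi p j 0 u `&` A) + pr P (Ukappa f phi p k u `&` A).
Proof.
move=> mA; elim: k => [|k ->]; first by rewrite big_ord0 add0r.
rewrite big_ord_recr /= -addrA; congr (_ + _).
rewrite (@pr_setID _ _ _ _ _ (Ukappa f phi p k.+1 u)); first last.
- exact: measurable_Ukappa.
- by apply: measurableI => //; exact: measurable_Ukappa.
rewrite addrC; congr (pr P _ + pr P _); apply/seteqP; split => x.
- by move=> [[Ux Ax] Ux']; split.
- by move=> [Ux Ax]; split => //; split => //; exact: subset_Ukappa.
- by move=> [[Ux Ax] nUx]; split => //; split.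
- by move=> [[Ux nUx] Ax]; exact: (conj (conj Ux Ax) nUx).
Qed.

(** A fixed level is studied with explicit errors: [K] bounds the counts, [g] is the gap, and [eta],
    [gam], [del] measure the defects in the mass of the annuli, in D and in D'. The bound on [g]
    makes room for [K.+1] further returns within the gap. *)
Variables (theta : R) (K g : nat) (eta gam del : R).
Hypothesis theta01 : 0 < theta < 1.
Hypothesis p_gt0 : (0 < p)%N.
Hypothesis no_early_return : forall i x, (0 < i < p)%N ->
  U phi u x -> ~ U phi u (iter i f x).
Hypothesis pr_Q_near : forall j, (j <= K)%N ->
  `|pr P (Q f phi p j 0 u) - theta * (1 - theta) ^+ j * h| <= eta.
Hypothesis decorrelation : forall j L, (j <= K)%N ->
  `|pr P (Q f phi p j 0 u `&` Ek g.+1 L) -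
    pr P (Q f phi p j 0 u) * pr P (Ek g.+1 L)| <= gam.
Hypothesis no_second_cluster : \sum_(1 <= i < g.+1)
  pr P (Q f phi p 0 0 u `&` iter i f @^-1` U phi u) <= del.
Hypothesis g_large : (K.+1 * p <= g)%N.

(** From the annulus of index [j] the times [p, ..., j p] exceed. A time that is not a multiple of
    [p] would be an early return from the preceding multiple. At [j p] the orbit lies in [Q^0], and
    the last hypothesis forbids exceedances during the next [g] steps. Time 0 is left out of the
    sum, hence [j] and not [j + 1]. *)
Lemma cluster_count j x : (j * p <= g)%N -> Q f phi p j 0 u x ->
  (forall i, (0 < i <= g)%N ->
     ~ (Q f phi p 0 0 u `&` iter i f @^-1` U phi u) (iter (j * p) f x)) ->
  (\sum_(1 <= t < 1 + g) exceed t x = j)%N.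
Proof.
move=> jg [/UkappaP Ux nUx] H.
have Q0 : Q f phi p 0 0 u (iter (j * p) f x).
  split; first exact: Ux.
  move=> /= [+ _] => Uj; apply: nUx; apply/UkappaP => i.
  rewrite leq_eqVlt => /orP[/eqP->|]; last exact: Ux.
  by rewrite mulSn iterD.
have Z : (\sum_((j * p).+1 <= i < g.+1) exceed i x = 0)%N.
  rewrite big_nat_cond big1// => i /andP[/andP[ji ig] _].
  apply/exceedN => Ui; apply: (H (i - j * p)%N).
    by rewrite subn_gt0 ji leq_subLR; lia.
  by split=> //=; rewrite -iterD subnK// ltnW.
rewrite add1n (@big_cat_nat _ _ _ (j * p).+1)//= Z addn0.
(* [j] is rewritten as the number of multiples of [p] among [1, ..., j p]. *)
rewrite -[RHS](mulnK j p_gt0) divn_count_dvd.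
rewrite big_nat_cond [RHS]big_nat_cond; apply: eq_bigr => i.
rewrite andbT => /andP[i0 ij]; have [/dvdnP[a ia]|pi] := boolP (p %| i)%N.
  apply/exceedE; rewrite ia; apply: Ux.
  by move: ij; rewrite ia ltnS leq_pmul2r.
apply/exceedN; rewrite {1}(divn_eq i p) addnC iterD.
apply: no_early_return; last apply: Ux.
  by rewrite lt0n pi ltn_pmod.
by rewrite -(leq_pmul2r p_gt0) (leq_trans (leq_trunc_div _ _)).
Qed.

(** The bracket is the cost of one annulus, and at most [K.+1] annuli contribute to a count
    [k <= K]. Its last term is a product: the mass of [U] times a bound for an exceedance inside the
    gap. *)
Let err := K.+1%:R * (del + gam + eta + h * (g%:R * h)).

(** Four replacements, one per error term: the cluster accounts for all points of the gap ([del]),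
    the pattern beyond the gap is decoupled ([gam]), the annulus gets its asymptotic mass ([eta]),
    and the decoupled pattern is extended back over the gap, which is wrong only if the gap contains
    an exceedance ([g h], weighted by [h]). *)
Lemma pr_Q_block_event m j k L : (j <= k)%N -> (k <= K)%N ->
  `|pr P (Q f phi p j 0 u `&` Ek 1 ((g + m, k)%N :: L)) -
    theta * (1 - theta) ^+ j * h * pr P (Ek 0 ((g + m, k - j)%N :: L))| <=
  del + gam + eta + h * (g%:R * h).
Proof.
move=> jk kK; have jK := leq_trans jk kK.
set A := Q _ _ _ _ _ _; pose C := Ek g.+1 ((m, k - j)%N :: L).
have mA : measurable A by exact: measurable_Q.
have mC : measurable C by exact: measurable_Ek.
have mB L' : measurable (Ek 1 L') by exact: measurable_Ek.
have mU t : measurable (iter t f @^-1` U phi u).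
  by apply: measurable_preimage_iter; exact: measurable_U.
have jg : (j * p <= g)%N.
  by apply: leq_trans g_large; rewrite leq_pmul2r// leqW.
have E1 : `|pr P (A `&` Ek 1 ((g + m, k)%N :: L)) - pr P (A `&` C)| <= del.
  (* A second cluster is observed from the last exceedance of the first one, at time [j p]; by
     invariance the bound [del] is the same for every [j]. *)
  pose D i := iter (j * p) f @^-1` (Q f phi p 0 0 u `&` iter i f @^-1` U phi u).
  have mD i : measurable (D i).
    apply: measurable_preimage_iter; apply: measurableI => //.
    exact: measurable_Q.
  pose I := index_iota 1 g.+1.
  apply: le_trans (@pr_near _ _ _ P _ _ (\bigcup_(i in [set` I]) D i) _ _ _ _)
    _.
  - exact: measurableI.
  - exact: measurableI.
  - by apply: fin_bigcup_measurable => //; exact: finite_seq.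
  - move=> x Dx; have S : A x -> (\sum_(1 <= t < 1 + g) exceed t x = j)%N.
      move=> Ax; apply: cluster_count => // i ig Qi; apply: Dx; exists i => //=.
      by rewrite mem_index_iota ltnS.
    split=> -[Ax]; [move=> /block_event_cat[_ B]|move=> Cx]; split => //.
      by move: B; rewrite S// add1n.
    by apply/block_event_cat; rewrite S.
  apply: le_trans (pr_bigcup_le _ _ mD) _; apply: le_trans no_second_cluster.
  apply: ler_sum => i _; rewrite pr_preimage_iter//; apply: measurableI => //.
  exact: measurable_Q.
have E2 := decorrelation ((m, k - j)%N :: L) jK; rewrite -/A -/C in E2.
have E3 := pr_Q_near jK; rewrite -/A in E3.
have E4 : `|pr P C - pr P (Ek 0 ((g + m, k - j)%N :: L))| <= g%:R * h.
  rewrite -(pr_block_event 1); pose I := index_iota 1 g.+1.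
  apply: le_trans (@pr_near _ _ _ P _ _
    (\bigcup_(i in [set` I]) (iter i f @^-1` U phi u)) _ _ _ _) _ => //.
  - by apply: fin_bigcup_measurable => //; exact: finite_seq.
  - move=> x Dx; have S : (\sum_(1 <= t < 1 + g) exceed t x = 0)%N.
      rewrite big_nat_cond big1// => t; rewrite andbT => tg;
        apply/exceedN => Ut.
      by apply: Dx; exists t => //=; rewrite mem_index_iota.
    split=> [Cx|/block_event_cat[_]]; last by rewrite S subn0.
    by apply/block_event_cat; rewrite S subn0.
  apply: le_trans (pr_bigcup_le _ _ mU) _.
  rewrite (eq_bigr (fun=> h)) => [|i _]; last first.
    by rewrite pr_preimage_iter//; exact: measurable_U.
  by rewrite sumr_const_nat subn1 /= mulr_natl.
have C0 := pr_ge0 P C; have C1 := pr_le1 P mC.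
have h0 := pr_ge0 P (U phi u).
have w01 : 0 <= theta * (1 - theta) ^+ j <= 1.
  have /andP[t0 t1] := theta01.
  have q0 : 0 <= 1 - theta by rewrite subr_ge0 ltW.
  apply/andP; split; first by rewrite mulr_ge0 ?exprn_ge0// ltW.
  rewrite mulr_ile1 ?exprn_ge0 ?exprn_ile1//; try exact: ltW.
  by rewrite gerBl ltW.
move: E1 E2 E3 E4 C0 C1 w01; set w := theta * _.
set a := pr P A; set c := pr P C; set x1 := pr P _; set x2 := pr P _.
set x3 := pr P (Ek 0 _); set G := g%:R * h => E1 E2 E3 E4 C0 C1 /andP[w0 w1].
have -> : x1 - w * h * x3 =
    (x1 - x2) + (x2 - a * c) + (a - w * h) * c + (w * h) * (c - x3) by ring.
have F3 : `|(a - w * h) * c| <= eta.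
  by rewrite normrM (ger0_norm C0); apply: le_trans E3; rewrite ler_piMr.
have F4 : `|(w * h) * (c - x3)| <= h * G.
  rewrite normrM (ger0_norm (mulr_ge0 w0 h0)); apply: ler_pM => //.
  - by rewrite mulr_ge0.
  - by rewrite ler_piMl.
apply: le_trans (ler_normD _ _) _; apply: lerD => //.
apply: le_trans (ler_normD _ _) _; apply: lerD => //.
by apply: le_trans (ler_normD _ _) _; apply: lerD.
Qed.

(** Points of [Ukappa k.+1] exceed at [p, ..., (k + 1) p], all within the gap: too many for a count
    [k], so only the annuli of index at most [k] contribute. *)
Lemma pr_U_block_event m k L : (k <= K)%N ->
  `|pr P (U phi u `&` Ek 1 ((g + m, k)%N :: L)) -
    h * \sum_(j < k.+1) theta * (1 - theta) ^+ j
          * pr P (Ek 0 ((g + m, k - j)%N :: L))| <= err.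
Proof.
move=> kK; rewrite (pr_U_split k.+1); last exact: measurable_Ek.
have -> : pr P (Ukappa f phi p k.+1 u `&` Ek 1 ((g + m, k)%N :: L)) = 0.
  rewrite -(pr0 P); congr (pr P _); apply/seteqP; split => x //.
  move=> [/UkappaP Ux /block_event_cat[+ _]]; apply/negP; rewrite -ltnNge.
  rewrite -[k.+1](mulnK _ p_gt0) divn_count_dvd add1n.
  have kg : (k.+1 * p <= g)%N by rewrite (leq_trans _ g_large)// leq_pmul2r.
  rewrite (@big_cat_nat _ _ _ (k.+1 * p).+1 1 g.+1)//= -[leqLHS]addn0.
  apply: leq_add => //; rewrite big_nat_cond [leqRHS]big_nat_cond.
  apply: leq_sum => i; rewrite andbT => /andP[i0 ik].
  have [/dvdnP[a ia]|//] := boolP (p %| i)%N.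
  rewrite -[leqLHS]/1%N ((exceedE i x).1 _)// ia; apply: Ux.
  by move: ik; rewrite ia ltnS leq_pmul2r.
rewrite addr0 mulr_sumr -sumrB; apply: le_trans (ler_norm_sum _ _ _) _.
set e := del + gam + eta + h * (g%:R * h).
have jK (j : 'I_k.+1) : `|pr P (Q f phi p j 0 u `&` Ek 1 ((g + m, k)%N :: L)) -
    h * (theta * (1 - theta) ^+ j * pr P (Ek 0 ((g + m, k - j)%N :: L)))| <= e.
  by rewrite [h * (_ * pr _ _)]mulrCA mulrA; apply: pr_Q_block_event => //;
    rewrite -ltnS.
apply: le_trans (ler_sum _ (fun j _ => jK j)) _.
rewrite sumr_const card_ord /err -/e -[e *+ _]mulr_natl ler_wpM2r ?ler_nat//.
exact: le_trans (normr_ge0 _) (jK ord0).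
Qed.

(** Split at time 0. Without an exceedance there, the pattern is merely shifted; so the increment is
    the mass on [U] with [k - 1] further points minus that with [k], and [geometric_generator]
    identifies it. Estimating both masses gives the factor 2. *)
Lemma block_event_step m k L : (k <= K)%N ->
  `|pr P (Ek 0 (((g + m).+1, k)%N :: L)) - pr P (Ek 0 ((g + m, k)%N :: L)) -
    theta * h * (\sum_(j < k.+1) geometric_pmf theta j *
       pr P (Ek 0 ((g + m, k - j)%N :: L)) - pr P (Ek 0 ((g + m, k)%N :: L)))|
    <= 2 * err.
Proof.
move=> kK; set X := fun k => pr P (Ek 0 ((g + m, k)%N :: L)).
have mU := measurable_U; have mE s L' := measurable_Ek s L'.
have E : pr P (Ek 0 (((g + m).+1, k)%N :: L)) - X k =
   (if k is k'.+1 then pr P (U phi u `&` Ek 1 ((g + m, k')%N :: L)) else 0) -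
   pr P (U phi u `&` Ek 1 ((g + m, k)%N :: L)).
  rewrite /X -(pr_block_event 1 ((g + m, k)%N :: L)).
  rewrite (pr_setID P (mE 0 _) mU) (pr_setID P (mE 1 _) mU).
  have -> : Ek 0 (((g + m).+1, k) :: L) `\` U phi u =
            Ek 1 ((g + m, k)%N :: L) `\` U phi u.
    apply/seteqP; split => x -[Ex Ux]; split => //;
      move/(exceedN 0) : (Ux) => H.
      by move/block_eventS : Ex => [_]; rewrite H subn0.
    by apply/block_eventS; rewrite H subn0.
  have -> : pr P (Ek 0 (((g + m).+1, k) :: L) `&` U phi u) =
      if k is k'.+1 then pr P (U phi u `&` Ek 1 ((g + m, k')%N :: L)) else 0.
    case: k {kK} => [|k].
      rewrite -(pr0 P); congr (pr P _); apply/seteqP; split => x //.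
      by move=> [/block_eventS[Ex _] /(exceedE 0) U1]; move: Ex; rewrite U1.
    congr (pr P _); apply/seteqP; split => x.
      move=> [/block_eventS[_ +] Ux].
      by rewrite ((exceedE 0 x).1 Ux) subSS subn0.
    move=> [Ux Ex]; split => //; apply/block_eventS.
    by rewrite ((exceedE 0 x).1 Ux) subSS subn0.
  rewrite [U phi u `&` Ek 1 ((g + m, k)%N :: L)]setIC.
  by rewrite opprD addrACA subrr addr0.
have G := geometric_generator theta X k.
rewrite E; set D := (D in theta * h * D).
have -> : theta * h * D = h * (theta * D) by ring.
rewrite {}/D -{}G.
have := pr_U_block_event m L kK; set a := pr P (U _ _ `&` _);
  set b := \sum_(j < k.+1) _.
case: k kK @X E a b => [|k] kK X E a b.
  move=> ab; rewrite (_ : _ - _ = - (a - h * b)); last ring.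
  rewrite normrN (le_trans ab)// ler_peMl ?ler1n//; exact: le_trans ab.
have := pr_U_block_event m L (ltnW kK); set a' := pr P (U _ _ `&` _);
  set b' := \sum_(j < k.+1) _.
move=> ab' ab.
rewrite (_ : _ - _ = (a' - h * b') - (a - h * b)); last ring.
by rewrite (le_trans (ler_normB _ _))// mulr_natl lerD.
Qed.

(** Blocks are added from the last to the first, the probability of the later ones being the initial
    value [c]; each new block adds its own gap cost and one local error per time. *)
Theorem block_event_renewal (rho : R) L : 0 <= rho <= 1 ->
  all (fun mk => mk.2 <= K)%N L ->
  `|pr P (Ek 0 L) - renewal_prob (geometric_pmf theta) rho L| <=
  (size L)%:R * (2 * h * g%:R) +
    (\sum_(mk <- L) mk.1)%:R * (2 * err + `|rho - theta * h|).
Proof.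
move=> r01; elim: L => [|[m k] L IH] /=.
  by rewrite prT subrr normr0 big_nil !mul0r addr0.
move=> /andP[kK {}/IH IH]; have /andP[t0 t1] := theta01.
have h0 := pr_ge0 P (U phi u); have h1 := pr_le1 P measurable_U.
have pi0 j : 0 <= geometric_pmf theta j by exact: geometric_pmf_ge0.
have pi1 n : \sum_(j < n.+1) geometric_pmf theta j <= 1.
  exact: sum_geometric_pmf_le1.
have mE s L' := measurable_Ek s L'.
have err0 : 0 <= err.
  exact: le_trans (normr_ge0 _) (pr_U_block_event 0 [::] (leq0n _)).
have err2 : 0 <= 2 * err by exact: mulr_ge0.
have h2 : 0 <= 2 * h by exact: mulr_ge0.
(* Below length [g] the increment of [X] and the generator term are each bounded by [h]; from [g] on
   the step lemma applies. *)
pose er i : R := (i < g)%N%:R * (2 * h) + 2 * err.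
set c := pr P (Ek 0 L) in IH; set c' := renewal_prob _ _ L in IH.
pose X m k := pr P (Ek 0 ((m, k) :: L)).
have X01 m' k' : 0 <= X m' k' <= 1 by rewrite pr_ge0 pr_le1.
apply: le_trans (renewal_block_approx (X := X) (err := er) (c := c)
  (a := theta * h) (K := K) (M := m) pi0 pi1 r01
  (renewal_prob01 pi0 pi1 r01 L) _ _ IH _ _ (leqnn m) kK) _.
- by apply/andP; split; [exact: mulr_ge0 (ltW t0) h0|
    exact: mulr_ile1 (ltW t0) h0 (ltW t1) h1].
- by move=> i; rewrite /er addr_ge0// mulr_ge0// ler0n.
- move=> k'; rewrite /X /c; case: eqP => [->|k0].
    by congr (pr P _); apply/seteqP; split => x;
      [move/block_event0 => []|move=> ?; apply/block_event0].
  rewrite -(pr0 P); congr (pr P _); apply/seteqP; split => x // /block_event0[].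
  by move/k0.
- move=> i k' _ kK'; rewrite /er; case: ltnP => ig; last first.
    by rewrite mul0r add0r /X -(subnKC ig); exact: block_event_step.
  rewrite mul1r; apply: le_trans (_ : 2 * h <= _);
    last by rewrite lerDl mulr_ge0.
  rewrite mulr2n mulrDl mul1r (le_trans (ler_normB _ _))// lerD//.
    rewrite /X -(pr_block_event 1 ((i, k') :: L)).
    apply: pr_near => //; first exact: measurable_U.
    move=> x /(exceedN 0) Ux; split => [/block_eventS[_]|Ex].
      by rewrite Ux subn0.
    by apply/block_eventS; rewrite Ux subn0.
  have th0 := mulr_ge0 (ltW t0) h0.
  rewrite normrM (ger0_norm th0) -[leRHS]mulr1 ler_pM//.
  - by rewrite ler_piMl// ltW.
  have S1 : \sum_(j < k'.+1) geometric_pmf theta j * X i (k' - j)%N <= 1.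
    apply: le_trans (ler_norm _) _; apply: sum_pi_norm_le => // j _.
    by have /andP[? ?] := X01 i j; rewrite ger0_norm.
  have S0 : 0 <= \sum_(j < k'.+1) geometric_pmf theta j * X i (k' - j)%N.
    by rewrite sumr_ge0// => j _; rewrite mulr_ge0//;
      case/andP: (X01 i (k' - j)%N).
  have /andP[? ?] := X01 i k'.
  by rewrite ler_norml; apply/andP; split; lra.
rewrite big_cons natrD mulrS.
rewrite [leRHS](_ : _ = (size L)%:R * (2 * h * g%:R) +
  (\sum_(mk <- L) mk.1)%:R * (2 * err + `|rho - theta * h|) +
  (g%:R * (2 * h) + m%:R * (2 * err + `|rho - theta * h|))); last by ring.
rewrite lerD2l /er.
under eq_bigr do rewrite -addrA.
rewrite big_split/= sumr_const card_ord -[_ *+ m](mulr_natl _ m) lerD2r.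
rewrite -mulr_suml ler_wpM2r// -natr_sum ler_nat.
have -> : (\sum_(i < m) (i < g) = minn m g)%N.
  elim: m => [|m IHm]; first by rewrite big_ord0 min0n.
  by rewrite big_ord_recr /= IHm; lia.
exact: geq_minr.
Qed.

End exceedances.

(** * Marks separated by memoryless gaps satisfy the recursion exactly *)

Section marked_renewal.
Variables (R : realType) (d : measure_display) (T : measurableType d).
Variables (P : probability T R) (V D : nat -> T -> nat).

(* The [i]-th mark [D i] sits at time [slot i], so that [V i] is the number of
   empty times between consecutive marks. *)
Definition slot (i : nat) (w : T) : nat := (\sum_(j < i.+1) V j w + i)%N.

(** The sum may stop at [i = t] because [slot i w >= i]; slots increase strictly, so at most one
    term is nonzero. *)
Definition mark (t : nat) (w : T) : nat :=
  (\sum_(i < t.+1) (slot i w == t) * D i w)%N.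

Lemma slotS i w : slot i.+1 w = (slot i w + V i.+1 w).+1.
Proof. by rewrite /slot big_ord_recr /=; lia. Qed.

Lemma slot_lt i j w : (i < j)%N -> (slot i w < slot j w)%N.
Proof.
elim: j => // j IH; rewrite ltnS leq_eqVlt slotS => /orP[/eqP->|/IH]; lia.
Qed.

Lemma slot_eq i j w : (slot i w == slot j w) = (i == j).
Proof.
by have [/(slot_lt w)|/(slot_lt w)|->] := ltngtP i j; lia.
Qed.

Lemma leq_slot i w : (i <= slot i w)%N.
Proof. by rewrite /slot leq_addl. Qed.

Lemma mark_slot i w : mark (slot i w) w = D i w.
Proof.
have iS : (i < (slot i w).+1)%N by rewrite ltnS leq_slot.
rewrite /mark (bigD1 (Ordinal iS))//= eqxx mul1n big1 ?addn0// => j.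
by rewrite slot_eq -val_eqE /= => /negbTE->.
Qed.

Lemma mark_eq0 t w : (forall i, slot i w != t) -> mark t w = 0%N.
Proof. by move=> H; rewrite /mark big1// => i _; rewrite (negbTE (H i)). Qed.

(** Exchange of the sums over times and over marks; [n] is any bound on the indices that can occur
    before [b]. *)
Lemma sum_mark a b n w : (forall i, (slot i w < b)%N -> (i < n)%N) ->
  (\sum_(a <= t < b) mark t w =
   \sum_(i < n) (a <= slot i w < b) * D i w)%N.
Proof.
move=> bn.
have E t : (t < b)%N -> (mark t w = \sum_(i < n) (slot i w == t) * D i w)%N.
  move=> tb; rewrite /mark.
  rewrite -(big_mkord xpredT (fun i => (slot i w == t) * D i w)%N).
  rewrite -(big_mkord xpredT (fun i => (slot i w == t) * D i w)%N).
  have Z x y : (forall i, (x <= i < y)%N -> slot i w != t) ->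
     (\sum_(x <= i < y) (slot i w == t) * D i w = 0)%N.
    by move=> H; rewrite big_nat_cond big1// => i /andP[/H/negbTE-> _].
  have [tn|nt] := leqP t.+1 n.
    rewrite [RHS](@big_cat_nat _ _ _ t.+1)//= [X in (_ + X)%N]Z ?addn0//.
    move=> i /andP[ti _]; have := leq_slot i w; lia.
  rewrite [LHS](@big_cat_nat _ _ _ n)//= 1?ltnW// [X in (_ + X)%N]Z ?addn0//.
  move=> i /andP[ni _]; apply/eqP => it.
  have := bn i; lia.
rewrite (eq_big_nat _ _ (F2 := fun t => \sum_(i < n) (slot i w == t) * D i
  w)%N).
  rewrite exchange_big/=; apply: eq_bigr => i _.
  rewrite -big_distrl/=; congr muln.
  have [it|nit] := boolP (a <= slot i w < b)%N.
    rewrite (big_rem (slot i w))/= ?mem_index_iota// eqxx big_seq_cond big1//.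
    move=> t; rewrite andbT rem_filter ?iota_uniq// mem_filter /=.
    by rewrite eq_sym => /andP[/negbTE->].
  rewrite big_nat_cond big1// => t /andP[tab _]; move: nit.
  by case: eqP tab => // <- ->.
by move=> t /andP[_ tb]; exact: E.
Qed.

Hypothesis mV : forall i j, measurable [set w | V i w = j].
Hypothesis mD : forall i j, measurable [set w | D i w = j].

Lemma measurable_mark t j : measurable [set w | mark t w = j].
Proof.
suff : forall (I : seq nat) j,
    measurable [set w | \sum_(i <- I) (slot i w == t) * D i w = j]%N.
  move=> /(_ (index_iota 0 t.+1) j).
  by under eq_set do rewrite big_mkord.
apply: measurable_nat_fiber_sum => i k.
have ms : measurable [set w | slot i w = t].
  have -> : [set w | slot i w = t] =
      [set w | \sum_(j <- index_iota 0 i.+1) V j w + i = t]%N.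
    by under [in RHS]eq_set do rewrite big_mkord.
  apply: measurable_nat_fiber_add; first exact: measurable_nat_fiber_sum.
  move=> l; have [->|il] := eqVneq i l.
    by rewrite (_ : mkset _ = setT)//; apply/seteqP; split.
  by rewrite (_ : mkset _ = set0)//; apply/seteqP; split => // x /= /eqP;
    rewrite (negbTE il).
rewrite (_ : mkset _ = ([set w | slot i w = t] `&` [set w | D i w = k]) `|`
  (~` [set w | slot i w = t] `&` (if k == 0%N then setT else set0))).
  apply: measurableU; first exact: measurableI.
  by apply: measurableI; [exact: measurableC|case: ifP].
apply/seteqP; split => w /=.
  case: eqP => st; first by rewrite mul1n; left.
  by rewrite mul0n => <-; right.
case=> [[-> <-]|[/eqP/negbTE->]]; first by rewrite eqxx mul1n.
by case: eqP => // ->.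
Qed.

Definition history (i : nat) (v e : nat -> nat) : set T :=
  [set w | forall j, (j < i)%N -> V j w = v j /\ D j w = e j].

Lemma measurable_history i v e : measurable (history i v e).
Proof.
rewrite (_ : history i v e = \bigcap_j
  (if (j < i)%N then [set w | V j w = v j] `&` [set w | D j w = e j] else
    setT)).
  apply: bigcap_measurable => // j _; case: ifP => // _; exact: measurableI.
apply/seteqP; split => w H j.
  by move=> _; case: ifP => // /H.
by move=> ji; have := H j I; rewrite ji.
Qed.

Definition gap_ge (i z : nat) : set T := [set w | (z <= V i w)%N].

Lemma measurable_gap_ge i z : measurable (gap_ge i z).
Proof.
rewrite (_ : gap_ge i z = \bigcup_(j in [set j | (z <= j)%N]) [set w | V i w =
  j]).
  by apply: bigcup_measurable => j _.
by apply/seteqP; split => w /=; [exists (V i w)|move=> [j /= zj E];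
  rewrite /gap_ge /= E].
Qed.

Variables (rho : R) (pi : nat -> R).
(** Geometric gaps and independent marks, seen from a history. The product form, instead of
    conditional probabilities, also covers histories of probability zero. *)
Hypothesis gap_memoryless : forall i z v e,
  pr P (history i v e `&` gap_ge i z.+1) =
  pr P (history i v e `&` gap_ge i z) * (1 - rho).
Hypothesis next_mark : forall i z k v e,
  pr P (history i v e `&` [set w | V i w = z /\ D i w = k]) =
  pr P (history i v e `&` gap_ge i z) * (rho * pi k).

Let extend (i z : nat) (v : nat -> nat) j := if j == i then z else v j.

Lemma history_extend i z k v e :
  history i.+1 (extend i z v) (extend i k e) =
  history i v e `&` [set w | V i w = z /\ D i w = k].
Proof.
rewrite /extend; apply/seteqP; split => w.
  move=> H; split=> [j ji|]; last by have := H i (ltnSn i); rewrite /= eqxx.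
  by have := H j (ltnW ji); rewrite ltn_eqF.
move=> [H Hi] j; rewrite ltnS leq_eqVlt => /orP[/eqP->|ji];
  first by rewrite eqxx.
by rewrite ltn_eqF//; exact: H.
Qed.

(** The first undecided time once [i] marks are placed and [z] empty times have followed the last
    one. *)
Let time (i z : nat) (v : nat -> nat) := (\sum_(j < i) v j + i + z)%N.

Lemma slot_history i v e w : history i v e w ->
  slot i w = time i (V i w) v /\ forall j, (j < i)%N -> (slot j w < time i 0
    v)%N.
Proof.
move=> H; have E : (\sum_(j < i) V j w = \sum_(j < i) v j)%N.
  by apply: eq_bigr => j _; have [] := H j (ltn_ord j).
have S : slot i w = time i (V i w) v.
  by rewrite /slot /time big_ord_recr /= E addnAC.
split=> // j; case: i {H S} E => // i E; rewrite ltnS => ji.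
have -> : time i.+1 0 v = (slot i w).+1 by rewrite /time /slot -E addn0 addnS.
by rewrite ltnS; move: ji; rewrite leq_eqVlt => /orP[/eqP->//|/(slot_lt
  w)/ltnW].
Qed.

(** The induction has to run over all states. At the undecided time either the gap grows, leading to
    [z.+1], or a mark of size [j] closes it, leading to [i.+1] and [z = 0] with an extended history.
    By memorylessness neither the history nor [z] affects the factor [renewal_prob]. *)
Theorem pr_renewal L i z v e :
  pr P (history i v e `&` gap_ge i z `&` block_event mark (time i z v) L) =
  pr P (history i v e `&` gap_ge i z) * renewal_prob pi rho L.
Proof.
elim: L i z v e => [|[m k] L IHL] i z v e; first by rewrite /= setIT mulr1.
rewrite [renewal_prob _ _ _]/=; elim: m k i z v e => [|m IHm] k i z v e;
  rewrite [renewal_block _ _ _ _ _]/=.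
  case: eqP => [->|k0].
    rewrite -IHL; congr (pr P _); apply/seteqP; split => w [Hw].
      by move=> /block_event0[_ ?].
    by move=> Ew; split => //; apply/block_event0.
  rewrite mulr0 -(pr0 P); congr (pr P _); apply/seteqP; split => w //.
  by move=> [_ /block_event0[/k0]].
have mE s L' : measurable (block_event mark s L').
  by apply: measurable_block_event; exact: measurable_mark.
have mG := measurable_gap_ge; have mH := measurable_history.
set A := _ `&` block_event _ _ _.
have tS : (time i z v).+1 = time i z.+1 v by rewrite /time !addnS.
have mA : measurable A by apply: measurableI => //; apply: measurableI.
rewrite (pr_setID P mA (mG i z.+1)).
have -> : A `&` gap_ge i z.+1 = history i v e `&` gap_ge i z.+1 `&`
    block_event mark (time i z.+1 v) ((m, k) :: L).
  have M0 w : history i v e w -> gap_ge i z.+1 w -> mark (time i z v) w = 0%N.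
    move=> /slot_history[si sj] zV; apply: mark_eq0 => j.
    have [/sj|/(slot_lt w)|->] := ltngtP j i;
      by move: zV; rewrite ?si /gap_ge /time /=; lia.
  apply/seteqP; split => w.
    move=> [[[Hw _] /block_eventS[_ +]] Vw].
    by rewrite M0// subn0 tS => Ew; split.
  move=> [[Hw Vw]]; rewrite -tS => Ew; split => //; split.
    by split => //; exact: ltnW.
  by apply/block_eventS; rewrite M0// subn0.
have MD w : A w -> (~` gap_ge i z.+1) w -> V i w = z /\ mark (time i z v) w = D
  i w.
  move=> [[Hw Vz] _] nV; have Ez : V i w = z.
    by move: Vz nV; rewrite /gap_ge /=; lia.
  by split => //; have [si _] := slot_history Hw; rewrite -Ez -si mark_slot.
rewrite IHm gap_memoryless.
rewrite (@pr_fiber _ _ _ P (A `\` _) (D i) k) => //; [|exact: measurableD|];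
  last first.
  move=> w [Aw nV]; have [_ <-] := MD w Aw nV.
  by case: Aw => _ /block_eventS[].
rewrite [RHS]mulrDr mulrA; congr (_ + _); first by rewrite mulrA.
rewrite !mulr_sumr; apply: eq_bigr => j _.
have -> : (A `\` gap_ge i z.+1) `&` [set w | D i w = j] =
    history i.+1 (extend i z v) (extend i j e) `&` gap_ge i.+1 0 `&`
    block_event mark (time i.+1 0 (extend i z v)) ((m, (k - j)%N) :: L).
  have -> : time i.+1 0 (extend i z v) = time i z.+1 v.
    rewrite /time big_ord_recr /= /extend eqxx addn0.
    rewrite (eq_bigr (fun j : 'I_i => v j)); first lia.
    by move=> l _; rewrite ltn_eqF.
  rewrite history_extend -tS; apply/seteqP; split => w.
    move=> [[Aw nV] Dw]; have [Vw Mw] := MD w Aw nV.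
    case: Aw => [[Hw Vz]] /block_eventS[_]; rewrite Mw Dw => Ew.
    by split => //; split.
  move=> [[[Hw [Vw Dw]] _] Ew].
  have nV : (~` gap_ge i z.+1) w by rewrite /gap_ge /= Vw ltnn.
  split => //; split => //; split; first by split => //; rewrite /gap_ge /= Vw.
  apply/block_eventS; have [si _] := slot_history Hw.
  have -> : mark (time i z v) w = j by rewrite -Vw -si mark_slot.
  by split => //; rewrite -ltnS.
rewrite IHm (_ : gap_ge i.+1 0 = setT) ?setIT; last by apply/seteqP; split.
by rewrite history_extend next_mark; ring.
Qed.

Corollary pr_block_event_mark L :
  pr P (block_event mark 0 L) = renewal_prob pi rho L.
Proof.
have := pr_renewal L 0 0 (fun=> 0%N) (fun=> 0%N).
rewrite /time big_ord0 /= (_ : history _ _ _ = setT).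
  by rewrite (_ : gap_ge _ _ = setT) ?setTI ?prT ?mul1r//; apply/seteqP; split.
by apply/seteqP; split.
Qed.

End marked_renewal.

(** * Exponential gaps rounded down to a grid *)

Lemma exponential_rate01 (R : realType) (theta h : R) : 0 < theta -> 0 < h ->
  0 <= 1 - expR (- theta * h) <= 1.
Proof.
move=> t0 h0; rewrite subr_ge0 gerBl expR_ge0 andbT -[leRHS]expR0 ler_expR.
by rewrite mulNr oppr_le0 mulr_ge0// ltW.
Qed.

Section exponential_gaps.
Variables (R : realType) (d : measure_display) (T : measurableType d).
Variables (P : probability T R) (theta : R) (pi : nat -> R).
Variables (W : nat -> {RV P >-> R}) (D : nat -> {RV P >-> nat}).
Hypothesis indepW : independent_seq P (fun i => W i : T -> R).
Hypothesis indepD : independent_seq P (fun i => D i : T -> nat).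
Hypothesis indepWD : forall A B, sigma_seq (fun i => W i : T -> R) A ->
  sigma_seq (fun i => D i : T -> nat) B -> P (A `&` B) = (P A * P B)%E.
Hypothesis lawW : forall i (A : set R), measurable A ->
  distribution P (W i) A = exponential_prob theta A.
Hypothesis lawD : forall i k, distribution P (D i) [set k] = (pi k)%:E.

Lemma measurable_preimageW i (A : set R) : measurable A ->
  measurable (W i @^-1` A).
Proof.
by move=> mA; have := measurable_funP (W i) measurableT _ mA; rewrite setTI.
Qed.

Lemma measurable_preimageD i (B : set nat) : measurable (D i @^-1` B).
Proof.
by rewrite -[X in measurable X]setTI;
  exact: (measurable_funP (D i) measurableT B).
Qed.

Lemma sigma_seq_bigcap d' (T' : measurableType d') (Y : nat -> T -> T')
    (s : seq nat) (A : nat -> set T') : (forall i, measurable (A i)) ->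
  sigma_seq Y (\bigcap_(i in [set` s]) (Y i @^-1` A i)).
Proof.
move=> mA; set G := \bigcup_i preimage_set_system setT (Y i) measurable.
have : measurable (\bigcap_(i in [set` s]) (Y i @^-1` A i) :
    set (g_sigma_algebraType G)).
  apply: fin_bigcap_measurable; first exact: finite_seq.
  move=> i _; apply: sub_sigma_algebra; exists i => //.
  by exists (A i) => //; rewrite setTI.
by [].
Qed.

Lemma pr_rectangle n (A : nat -> set R) (B : nat -> set nat) :
  (forall i, measurable (A i)) ->
  pr P [set w | forall i, (i < n)%N -> A i (W i w) /\ B i (D i w)] =
  (\prod_(i < n) pr P (W i @^-1` A i)) * \prod_(i < n) pr P (D i @^-1` B i).
Proof.
move=> mA; have mB i : measurable (B i) by [].
pose s := index_iota 0 n.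
have -> : [set w | forall i, (i < n)%N -> A i (W i w) /\ B i (D i w)] =
    \bigcap_(i in [set` s]) (W i @^-1` A i) `&`
    \bigcap_(i in [set` s]) (D i @^-1` B i).
  apply/seteqP; split => w.
    by move=> H; split => i; rewrite /= mem_index_iota => /= /H[].
  by move=> [HW HD] i ni; split; [apply: HW|apply: HD];
    rewrite /= mem_index_iota.
rewrite /pr indepWD; [|exact: sigma_seq_bigcap|exact: sigma_seq_bigcap].
rewrite indepW ?iota_uniq// indepD ?iota_uniq//.
have EW i := prE P (measurable_preimageW i (mA i)).
have ED i := prE P (measurable_preimageD i (B i)).
rewrite (eq_bigr _ (fun i _ => EW i)) (eq_bigr _ (fun i _ => ED i)).
by rewrite !prodEFin -EFinM /= !big_mkord.
Qed.

Variable h : R.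
Hypothesis h_gt0 : 0 < h.

Definition gap (i : nat) (w : T) : nat := Num.truncn (W i w / h).

(** [truncn] sends negative numbers to 0, so [tail 0] is the whole line. *)
Let tail z : set R := [set x | (z <= Num.truncn (x / h))%N].

Lemma tailS z : tail z.+1 = `[z.+1%:R * h, +oo[%classic.
Proof.
apply/seteqP; split => x; rewrite /tail /= in_itv/= andbT truncn_gt_nat.
  by rewrite ler_pdivlMr.
by rewrite ler_pdivlMr.
Qed.

Lemma measurable_tail z : measurable (tail z).
Proof.
case: z => [|z]; last by rewrite tailS.
by rewrite (_ : tail 0 = setT)//; apply/seteqP; split.
Qed.

Let value z : set R := [set x | Num.truncn (x / h) = z].

Lemma valueE z : value z = tail z `\` tail z.+1.
Proof.
apply/seteqP; split => x; rewrite /value /tail /=; first by move=> <-;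
  rewrite ltnn leqnn.
by move=> [zx /negP]; rewrite -leqNgt => xz; apply/eqP; rewrite eqn_leq zx xz.
Qed.

Lemma measurable_value z : measurable (value z).
Proof. by rewrite valueE; apply: measurableD; exact: measurable_tail. Qed.

Lemma exponential_prob_ltr a : 0 < a ->
  exponential_prob theta `]-oo, a[%classic = (1 - expR (- theta * a))%:E.
Proof.
(* [exponential_prob] is replaced by the law of [W 0] in order to use additivity of a measure; the
   density vanishes on the negative half-line. *)
move=> a0; rewrite -(lawW 0)// (_ : `]-oo, a[%classic =
   `]-oo, (0:R)[%classic `|` `[0, a[%classic); last first.
  apply/seteqP; split => x; rewrite /= !in_itv/=.
    by move=> xa; have [x0|x0] := ltP x 0; [left|right; rewrite xa].
  by case=> [x0|/andP[]//]; exact: lt_trans a0.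
pose A0 : set R := `]-oo, 0[%classic; pose A1 : set R := `[0, a[%classic.
transitivity (distribution P (W 0) A0 + distribution P (W 0) A1)%E.
  apply: measureU => //; apply/seteqP; split => x //=.
  by rewrite !in_itv/= => -[x0 /andP[]]; rewrite leNgt x0.
have Z : exponential_prob theta A0 = 0%E.
  apply: integral0_eq => x; rewrite /A0 /= in_itv/= => x0.
  by rewrite lt0_exponential_pdf.
have mA0 : measurable A0 by exact: measurable_itv.
have mA1 : measurable A1 by exact: measurable_itv.
rewrite !lawW// Z add0e /exponential_prob /A1 integral_itv_bndo_bndc;
  last first.
  apply/measurable_EFinP; apply: measurable_funTS.
  exact: measurable_exponential_pdf.
by rewrite -/(exponential_prob _ _) exponential_prob_itv0c.
Qed.

Lemma pr_tail i z : pr P (W i @^-1` tail z) = expR (- theta * (z%:R * h)).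
Proof.
case: z => [|z].
  rewrite (_ : _ @^-1` _ = setT) ?prT ?mul0r ?mulr0 ?expR0//.
  by apply/seteqP; split.
pose A : set R := `]-oo, z.+1%:R * h[%classic.
have mA : measurable A by exact: measurable_itv.
have -> : W i @^-1` tail z.+1 = setT `\` W i @^-1` A.
  rewrite tailS; apply/seteqP; split => w; rewrite /A /= !in_itv/= andbT.
    by move=> Ww; split => //; apply/negP; rewrite -leNgt.
  by move=> [_ /negP]; rewrite -leNgt.
rewrite pr_setD ?prT//; last exact: measurable_preimageW.
have -> : pr P (W i @^-1` A) = 1 - expR (- theta * (z.+1%:R * h)).
  rewrite -[RHS]/(fine (1 - expR _)%:E) -exponential_prob_ltr ?mulr_gt0//.
  by rewrite -(lawW i).
by ring.
Qed.

Let rho := 1 - expR (- theta * h).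

Lemma pr_tailS i z :
  pr P (W i @^-1` tail z.+1) = pr P (W i @^-1` tail z) * (1 - rho).
Proof. by rewrite !pr_tail /rho opprB addrC subrK -expRD; congr expR; ring. Qed.

Lemma pr_value i z :
  pr P (W i @^-1` value z) = pr P (W i @^-1` tail z) * rho.
Proof.
rewrite valueE (_ : _ @^-1` _ = W i @^-1` tail z `\` W i @^-1` tail z.+1)//.
rewrite pr_setD; first by rewrite pr_tailS; ring.
- exact: measurable_preimageW (measurable_tail _).
- exact: measurable_preimageW (measurable_tail _).
- by move=> w /ltnW.
Qed.

(** History and next pair form a rectangle of length [i + 1] whose first [i] factors are those of
    the history alone. *)
Lemma pr_history_next i v e (A : set R) (B : set nat) : measurable A ->
  pr P (history gap D i v e `&` [set w | A (W i w) /\ B (D i w)]) =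
  pr P (history gap D i v e) * pr P (W i @^-1` A) * pr P (D i @^-1` B).
Proof.
move=> mA.
pose A' j := if (j < i)%N then value (v j) else A.
pose B' j := if (j < i)%N then [set e j] else B.
have mA' j : measurable (A' j).
  by rewrite /A'; case: ifP => // _; exact: measurable_value.
have E n : (n <= i)%N -> [set w | forall j, (j < n)%N -> A' j (W j w) /\ B' j
  (D j w)] =
    history gap D n v e.
  move=> ni; apply/seteqP; split => w H j jn; have := H j jn;
    by rewrite /A' /B' (leq_trans jn ni).
have H n := pr_rectangle n B' mA'.
have := H i.+1; rewrite !big_ord_recr /=.
have := H i; rewrite E// => ->.
rewrite /A' /B' ltnn => {}H.
rewrite (_ : _ `&` _ = [set w | forall j, (j < i.+1)%N ->
    A' j (W j w) /\ B' j (D j w)]); first by rewrite H; ring.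
rewrite -E//; apply/seteqP; split => w.
  move=> [Hw Hi] j; rewrite ltnS leq_eqVlt => /orP[/eqP->|]; last exact: Hw.
  by rewrite /A' /B' ltnn.
move=> Hw; split=> [j ji|]; first by apply: Hw; exact: ltnW.
by have := Hw i (ltnSn i); rewrite /A' /B' ltnn.
Qed.

Lemma measurable_gap i j : measurable [set w | gap i w = j].
Proof. exact: measurable_preimageW (measurable_value j). Qed.

Lemma measurable_size i j : measurable [set w | D i w = j].
Proof. exact: (measurable_preimageD i [set j]). Qed.

Theorem pr_block_event_exponential L :
  pr P (block_event (mark gap D) 0 L) = renewal_prob pi rho L.
Proof.
have ge i z v e : history gap D i v e `&` gap_ge gap i z =
    history gap D i v e `&` [set w | tail z (W i w) /\ [set: nat] (D i w)].
  by apply/seteqP; split => w [Hw]; [split|case].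
apply: pr_block_event_mark.
- exact: measurable_gap.
- exact: measurable_size.
- move=> i z v e; rewrite !ge !pr_history_next; try exact: measurable_tail.
  by rewrite pr_tailS; ring.
- move=> i z k v e; rewrite ge pr_history_next; last exact: measurable_tail.
  have := pr_history_next i v e [set k] (measurable_value z).
  rewrite pr_value => H; apply: (etrans H).
  rewrite (_ : D i @^-1` [set: nat] = setT) ?prT; last by apply/seteqP; split.
  rewrite [pr P (D i @^-1` [set k])](_ : _ = pi k); first ring.
  by have := lawD i k; rewrite /pr /distribution /pushforward => ->.
Qed.

End exponential_gaps.

(** * Cells, their grid indices, and the points that decide the cell counts *)

Section cells.
Variables (R : realType) (a : nat -> R) (r : nat).
Hypotheses (a0 : a 0%N = 0) (a_nd : forall j, a j <= a j.+1).

Lemma le_cells i j : (i <= j)%N -> a i <= a j.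
Proof. by move=> ij; apply: (homo_leq le_refl le_trans a_nd). Qed.

Lemma cells_ge0 j : 0 <= a j.
Proof. by rewrite -a0 le_cells. Qed.

Lemma cells_partition x n : 0 <= x ->
  (\sum_(j < n) (a j <= x < a j.+1)%R = (x < a n)%R :> nat)%N.
Proof.
move=> x0; elim: n => [|n IH].
  by rewrite big_ord0 a0 ltNge x0.
rewrite big_ord_recr /= IH; have := a_nd n.
have [xa|ax] := ltP x (a n) => an /=; last by rewrite add0n.
by rewrite (lt_le_trans xa an).
Qed.

(* Index of the first time [t] with [t.+1 * h >= b]: the point of a cluster in
   the time slot [t] is placed at [t.+1 * h], so that it converges to its limit
   from the right. *)
Definition cell_index (h b : R) : nat := (`|Num.ceil (b / h)|%N).-1.

Lemma cell_indexP h b t : 0 < h -> 0 <= b ->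
  (t < cell_index h b)%N = (t.+1%:R * h < b).
Proof.
move=> h0 b0; rewrite -ltr_pdivlMr// -[t.+1%:R]/((t.+1 : int)%:~R) -ceil_gt_int.
have : 0 <= Num.ceil (b / h) by rewrite ceil_ge0 (lt_le_trans _ (divr_ge0 _
  (ltW h0)))// ltrN10.
rewrite /cell_index; case: (Num.ceil (b / h)) => // m _ /=.
by rewrite ltz_nat; case: m.
Qed.

Lemma cell_index0 h : cell_index h 0 = 0%N.
Proof. by rewrite /cell_index mul0r ceil0. Qed.

Lemma le_cell_index h i : 0 < h ->
  (cell_index h (a i) <= cell_index h (a i.+1))%N.
Proof.
move=> h0; rewrite leqNgt; apply/negP.
rewrite cell_indexP ?cells_ge0// => H.
have : (cell_index h (a i.+1) < cell_index h (a i.+1))%N.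
  by rewrite cell_indexP ?cells_ge0//; exact: lt_le_trans (a_nd i).
by rewrite ltnn.
Qed.

Definition cell_blocks (h : R) (kap : nat -> nat) : seq (nat * nat) :=
  mkseq (fun j => (cell_index h (a j.+1) - cell_index h (a j), kap j)%N) r.

Lemma cell_index_le h i : 0 < h -> (cell_index h (a i))%:R <= a i / h.
Proof.
move=> h0; case E : (cell_index h (a i)) => [|k].
  by rewrite divr_ge0 ?cells_ge0// ltW.
by rewrite ler_pdivlMr// ltW// -cell_indexP ?cells_ge0// E.
Qed.

Lemma sum_cell_blocks h kap : 0 < h ->
  (\sum_(mk <- cell_blocks h kap) mk.1 = cell_index h (a r))%N.
Proof.
move=> h0; rewrite big_map /= -[r in iota 0 r]subn0 -/(index_iota 0 r).
rewrite (telescope_sumn_in (f := fun j => cell_index h (a j)))//.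
  by rewrite a0 cell_index0 subn0.
by move=> j _; exact: le_cell_index.
Qed.

Variables (arr : nat -> R) (D : nat -> nat).
Hypotheses (arr0 : 0 <= arr 0%N) (arr_nd : forall i, arr i <= arr i.+1).
Hypothesis D_gt0 : forall i, (0 < D i)%N.

Lemma le_arr i j : (i <= j)%N -> arr i <= arr j.
Proof. by move=> ij; apply: (homo_leq le_refl le_trans arr_nd). Qed.

(** Limited to the first [S.+1] points, so that it depends on finitely many arrivals even if [arr]
    does not tend to infinity. *)
Definition early_count (S j : nat) : nat :=
  (\sum_(i < S.+1) (a j <= arr i < a j.+1)%R * D i)%N.

(** The points [0, ..., S] all lie before [a r], each in one cell and with mass at least 1. *)
Lemma early_count_gt S : arr S < a r -> (S < \sum_(j < r) early_count S j)%N.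
Proof.
move=> Sr; rewrite exchange_big/=.
apply: leq_trans (_ : \sum_(i < S.+1) 1 <= _)%N.
  by rewrite sum1_card card_ord.
apply: leq_sum => i _; rewrite -big_distrl/= cells_partition; last first.
  by apply: le_trans arr0 _; exact: le_arr.
rewrite (le_lt_trans _ Sr) ?mul1n//.
by apply: le_arr; rewrite -ltnS.
Qed.

Lemma early_count_late S S' j : a r <= arr S -> (S <= S')%N -> (j < r)%N ->
  early_count S' j = early_count S j.
Proof.
move=> late SS' jr.
rewrite /early_count -!(big_mkord xpredT (fun i => (a j <= arr i < a j.+1)%R *
  D i)%N).
rewrite (@big_cat_nat _ _ _ S.+1)//= [X in (_ + X)%N]big1_seq ?addn0// => i.
rewrite mem_index_iota => /andP[_ /andP[Si _]].
have : a j.+1 <= arr i.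
  by rewrite (le_trans (le_cells jr))// (le_trans late)// le_arr// ltnW.
by rewrite leNgt => /negbTE ->; rewrite andbF.
Qed.

(* As every mark is at least [1], the first [kap 0 + ... + kap (r-1) + 1] points
   decide whether the cells carry the masses [kap]. *)
Lemma early_countP (M kap : nat -> nat) (S := (\sum_(j < r) kap j)%N) :
  (forall j, (j < r)%N -> early_count S j <= M j)%N ->
  (a r <= arr S -> forall j, (j < r)%N -> M j = early_count S j) ->
  (forall j, (j < r)%N -> M j = kap j) <->
  (a r <= arr S /\ forall j, (j < r)%N -> early_count S j = kap j).
Proof.
move=> Mge Meq; split=> [H|[late H] j jr]; last by rewrite Meq// H.
have [late|early] := leP (a r) (arr S).
  by split=> // j jr; rewrite -Meq// H.
have := early_count_gt early; rewrite ltnNge => /negP[]; apply: leq_sum => j _.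
by rewrite -H// Mge.
Qed.

End cells.

(** * From the rounded process to the true arrival times *)

Section discretisation.
Variables (R : realType) (d : measure_display) (T : measurableType d).
Variables (h : R) (W : nat -> T -> R).
Variables (D : nat -> T -> nat) (a : nat -> R) (r : nat) (w : T).
Hypothesis h_gt0 : 0 < h.
Hypotheses (a0 : a 0%N = 0) (a_nd : forall j, a j <= a j.+1).
Hypotheses (W_ge0 : forall i, 0 <= W i w) (D_gt0 : forall i, (0 < D i w)%N).

Let V i w := Num.truncn (W i w / h).
Local Notation arr := (arrival (fun j => W j w)).

Lemma arrivalS i : arr i.+1 = arr i + W i.+1 w.
Proof. by rewrite /arrival big_ord_recr. Qed.

Lemma arrival0_ge0 : 0 <= arr 0%N.
Proof. by rewrite /arrival big_ord1. Qed.

Lemma arrival_nd i : arr i <= arr i.+1.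
Proof. by rewrite arrivalS lerDl. Qed.

(** Rounding takes at most [h] from each of the [i + 1] gaps, while the [i] earlier occupied slots
    and the shift by one give back [(i + 1) h]: the grid point never precedes the arrival. *)
Lemma slot_arrival i :
  arr i <= (slot V i w).+1%:R * h <= arr i + i.+1%:R * h.
Proof.
have Vh j : (V j w)%:R * h <= W j w <= (V j w).+1%:R * h.
  have /truncn_itv/andP[H1 H2] : 0 <= W j w / h by rewrite divr_ge0// ltW.
  by rewrite -ler_pdivlMr// H1 -ler_pdivrMr// ltW.
have E : (slot V i w).+1%:R * h = \sum_(j < i.+1) (V j w)%:R * h + i.+1%:R * h.
  by rewrite /slot -addnS natrD mulrDl natr_sum mulr_suml.
apply/andP; split; last first.
  by rewrite E lerD2r; apply: ler_sum => j _; case/andP: (Vh j).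
rewrite E -[i.+1 in X in _ + X]card_ord -sum1_card natr_sum mulr_suml
  -big_split/=.
by apply: ler_sum => j _; rewrite -mulrDl natr1; case/andP: (Vh j).
Qed.

(** For a fixed pattern only finitely many comparisons of points with cell ends matter; if rounding
    respects these, it respects the event. *)
Lemma block_event_cells_mark (kap : nat -> nat) (S := (\sum_(j < r) kap j)%N) :
  (forall i j, (i <= S)%N -> (j <= r)%N ->
    ((slot V i w).+1%:R * h < a j) = (arr i < a j)) ->
  block_event (mark V D) 0 (cell_blocks a r h kap) w <->
  (a r <= arr S /\
   forall j, (j < r)%N -> early_count a arr (D^~ w) S j = kap j).
Proof.
move=> same; pose k j := cell_index h (a j).
have k0 : k 0%N = 0%N by rewrite /k a0 cell_index0.
have kS i j : (i <= S)%N -> (j <= r)%N -> (slot V i w < k j)%N = (arr i < a j).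
  by move=> iS jr; rewrite cell_indexP ?cells_ge0// same.
have := @block_event_cells _ (mark V D) 0 r k kap w.
rewrite k0 add0n => ->; last by move=> j _; exact: le_cell_index.
apply: (@early_countP _ a r a0 a_nd arr (D^~ w) arrival0_ge0 arrival_nd D_gt0
  (fun j => \sum_(k j <= t < k j.+1) mark V D t w)%N kap).
- move=> j jr; pose n := maxn S.+1 (k j.+1).
  rewrite (@sum_mark _ _ V D (k j) (k j.+1) n w); last first.
    by move=> i ij; rewrite leq_max (leq_ltn_trans (leq_slot V i w) ij) orbT.
  rewrite /early_count -(big_mkord xpredT (fun i => (a j <= arr i < a j.+1)%R *
    D i w)%N).
  rewrite -(big_mkord xpredT (fun i => (k j <= slot V i w < k j.+1) * D i w)%N).
  rewrite [leqRHS](@big_cat_nat _ _ _ S.+1) ?leq_maxl//=.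
  apply: leq_trans (leq_addr _ _); rewrite leq_eqVlt; apply/orP; left;
    apply/eqP.
  apply: eq_big_nat => i /andP[_ iS].
  by rewrite (leqNgt (k j)) !kS -?leNgt// ltnW.
- move=> late j jr; rewrite (@sum_mark _ _ V D (k j) (k j.+1) S.+1 w).
    apply: eq_bigr => i _; have iS : (i <= S)%N by rewrite -ltnS.
    by rewrite (leqNgt (k j)) !kS -?leNgt// ltnW.
  move=> i; apply: contraLR; rewrite -!leqNgt => Si.
  have kr : (k j.+1 <= k r)%N.
    apply: (homo_leq leqnn leq_trans (f := k)) => // l; exact: le_cell_index.
  apply: leq_trans kr _; rewrite leqNgt; apply/negP => ir.
  have : (slot V S w < k r)%N.
    by apply: leq_ltn_trans ir; apply/ltnW/slot_lt.
  by rewrite kS// ltNge late.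
Qed.

End discretisation.

Lemma pr_cvg (R : realType) (d : measure_display) (T : measurableType d)
    (P : probability T R) (A : nat -> set T) (B : set T) :
  (forall n, measurable (A n)) -> measurable B ->
  (forall w, \forall n \near \oo, A n w <-> B w) ->
  pr P (A n) @[n --> \oo] --> pr P B.
Proof.
move=> mA mB AB; apply: fine_cvg; rewrite -prE//.
have E C : measurable C -> P C = (\int[P]_x (\1_C x)%:E)%E.
  by move=> mC; rewrite integral_indic// setIT.
rewrite E//; under eq_fun do rewrite E//.
apply: (@dominated_cvg _ _ _ _ _ measurableT _ _ (cst 1%E)) => //.
- by move=> n; apply/measurable_EFinP; exact: measurable_indic.
- move=> w _; apply: cvg_near_cst; apply: filterS (AB w) => n ABn.
  by rewrite !indicE; congr (_%:R%:E); apply: congr1;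
    apply/idP/idP => /set_mem /ABn ?; apply/mem_set.
- by apply: finite_measure_integrable_cst.
- by move=> n w _; rewrite /= indicE lee_fin normr_nat; case: (_ \in _);
  rewrite ?lexx ?ler01.
Qed.

(** * Limit of the renewal probabilities *)

Section compound_poisson_limit.
Variables (R : realType) (d : measure_display) (T : measurableType d).
Variables (P : probability T R) (theta : R) (pi : nat -> R).
Variables (W : nat -> {RV P >-> R}) (D : nat -> {RV P >-> nat}).
Hypothesis indepW : independent_seq P (fun i => W i : T -> R).
Hypothesis indepD : independent_seq P (fun i => D i : T -> nat).
Hypothesis indepWD : forall A B, sigma_seq (fun i => W i : T -> R) A ->
  sigma_seq (fun i => D i : T -> nat) B -> P (A `&` B) = (P A * P B)%E.
Hypothesis lawW : forall i (A : set R), measurable A ->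
  distribution P (W i) A = exponential_prob theta A.
Hypothesis lawD : forall i k, distribution P (D i) [set k] = (pi k)%:E.
Hypothesis pi0 : pi 0%N = 0.

Local Notation arr w := (arrival (fun j => W j w)).

Definition regular : set T := [set w | forall i, 0 <= W i w /\ (0 < D i w)%N].

Lemma regularE : regular = \bigcap_i (W i @^-1` `[0, +oo[ `&` D i @^-1` [set~
  0%N]).
Proof.
apply/seteqP; split => w H i.
  move=> _; have [H1 H2] := H i; split; first by rewrite /= in_itv/= H1.
  by move=> /= D0; rewrite D0 in H2.
have [+ H2] := H i I; rewrite /= in_itv/= andbT => H1; split => //.
by rewrite lt0n; apply/eqP.
Qed.

Lemma measurable_regular : measurable regular.
Proof.
rewrite regularE; apply: bigcap_measurable => // i _; apply: measurableI.
  exact: measurable_preimageW (measurable_itv _).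
exact: measurable_preimageD.
Qed.

Lemma pr_regular : P (~` regular) = 0%E.
Proof.
rewrite regularE setC_bigcap; apply/negligibleP.
  apply: bigcup_measurable => i _; apply: measurableC; apply: measurableI.
    exact: measurable_preimageW (measurable_itv _).
  exact: measurable_preimageD.
apply: negligible_bigcup => i; rewrite setCI; apply: negligibleU.
  exists (W i @^-1` `]-oo, 0[); split.
  - exact: measurable_preimageW (measurable_itv _).
  - apply: etrans (lawW i (measurable_itv `]-oo, 0[)) _.
    by apply: integral0_eq => x; rewrite /= in_itv/= => x0;
      rewrite lt0_exponential_pdf.
  - by move=> w /=; rewrite !in_itv/= andbT => /negP; rewrite -ltNge.
exists (D i @^-1` [set 0%N]); split.
- exact: measurable_preimageD.
- by apply: etrans (lawD i 0%N) _; rewrite pi0.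
- by move=> w /= /contrapT.
Qed.

Lemma pr_setI_regular A : measurable A -> pr P (A `&` regular) = pr P A.
Proof.
move=> mA; rewrite (pr_setID P mA measurable_regular) [X in _ + X](_ : _ = 0)
  ?addr0//.
apply/eqP; rewrite eq_le pr_ge0 andbT.
have -> : 0 = pr P (~` regular) by rewrite /pr pr_regular.
have mR := measurable_regular.
apply: le_pr; [exact: measurableD|exact: measurableC|by move=> w []].
Qed.

Lemma measurable_arrival i : measurable_fun setT (fun w => arr w i).
Proof. by apply: measurable_sum => j; exact: measurable_funP. Qed.

Variables (a : nat -> R) (r : nat).
Hypotheses (a0 : a 0%N = 0) (a_nd : forall j, a j <= a j.+1).

(** Expressed through the first arrivals only, and restricted to the almost sure set [regular],
    where arrivals are monotone and marks positive, so that the limit can be taken outcome by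
    outcome. *)
Definition limit_event (kap : nat -> nat) : set T :=
  [set w | let S := (\sum_(j < r) kap j)%N in
    a r <= arr w S /\
    forall j, (j < r)%N -> early_count a (arr w) (fun i => D i w) S j = kap j]
  `&` regular.

Lemma limit_event_inj kap kap' w : limit_event kap w -> limit_event kap' w ->
  forall j, (j < r)%N -> kap j = kap' j.
Proof.
move=> [[late H] reg] [[late' H'] _] j jr; rewrite -H// -H'//.
have arrS i : arr w i <= arr w i.+1.
  by apply: (@arrival_nd _ _ T (fun i => W i : T -> R)) => l; case: (reg l).
set S := (\sum_(j < r) kap j)%N in late *;
  set S' := (\sum_(j < r) kap' j)%N in late' *.
have [SS'|/ltnW S'S] := leqP S S'.
  by rewrite [RHS](early_count_late a_nd _ arrS late).
by rewrite (early_count_late a_nd _ arrS late').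
Qed.

Lemma measurable_limit_event kap : measurable (limit_event kap).
Proof.
apply: measurableI; last exact: measurable_regular.
set S := (\sum_(j < r) kap j)%N.
have mge i b : measurable [set w | b <= arr w i].
  have := measurable_arrival i measurableT (measurable_itv `[b, +oo[).
  rewrite setTI (_ : _ @^-1` _ = [set w | b <= arr w i])//.
  by apply/seteqP; split => w /=; rewrite in_itv/= andbT.
have mcell i j : measurable [set w | a j <= arr w i < a j.+1].
  rewrite (_ : mkset _ = [set w | a j <= arr w i] `\` [set w | a j.+1 <= arr w
    i]).
    exact: measurableD.
  apply/seteqP; split => w /=.
    by move=> /andP[-> x]; split => //; apply/negP; rewrite -ltNge.
  by move=> [-> /negP]; rewrite -ltNge.
rewrite (_ : mkset _ = [set w | a r <= arr w S] `&` \bigcap_j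
  (if (j < r)%N then
     [set w | early_count a (arr w) (fun i => D i w) S j = kap j] else setT)).
  apply: measurableI => //; apply: bigcap_measurable => // j _;
    case: ifP => // _.
  under eq_set do rewrite /early_count -(big_mkord xpredT
     (fun i => (a j <= arrival (fun l => W l _) i < a j.+1)%R * D i _)%N).
  apply: measurable_nat_fiber_sum => i k.
  rewrite (_ : mkset _ =
    ([set w | a j <= arr w i < a j.+1] `&` [set w | D i w = k]) `|`
    (~` [set w | a j <= arr w i < a j.+1] `&` (if k == 0%N then setT else
      set0))).
    apply: measurableU; apply: measurableI => //; try exact: measurable_size.
      exact: measurableC.
    by case: ifP.
  apply/seteqP; split => w /=.
    case: (boolP (a j <= arr w i < a j.+1)) => [c|/negP c].
      by rewrite mul1n => <-; left.
    by rewrite mul0n => <-; right.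
  case=> [[-> <-]|[/negP/negbTE->]]; first by rewrite mul1n.
  by case: eqP => // ->.
apply/seteqP; split => w /=.
  by move=> [? H]; split => // j _; case: ifP => // /H.
by move=> [? H]; split => // j jr; have := H j I; rewrite jr.
Qed.

(** The left side is the probability of an event of the rounded process. On [regular] these events
    agree with [limit_event] once [h n] is small, for every outcome, and dominated convergence
    concludes. *)
Lemma cvg_renewal_prob (h : nat -> R) kap :
  (\forall n \near \oo, 0 < h n) -> h n @[n --> \oo] --> 0 ->
  renewal_prob pi (1 - expR (- theta * h n)) (cell_blocks a r (h n) kap)
    @[n --> \oo] --> pr P (limit_event kap).
Proof.
move=> h_gt0 h0; pose V n := gap W (h n); pose S := (\sum_(j < r) kap j)%N.
(* The default [set0] makes [B n] measurable for every [n]; it is taken for finitely many [n]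
   only. *)
pose B n := if 0 < h n then
  block_event (mark (V n) (fun i => D i : T -> nat)) 0 (cell_blocks a r (h n)
    kap)
  else set0.
have mB n : measurable (B n).
  rewrite /B; case: ifP => // hn.
  apply: measurable_block_event => t j; apply: measurable_mark => i k.
    exact: measurable_gap hn _ _.
  exact: measurable_size.
have mR := measurable_regular.
have H : pr P (B n `&` regular) @[n --> \oo] --> pr P (limit_event kap).
  apply: pr_cvg; [|exact: measurable_limit_event|].
    by move=> n; exact: measurableI.
  move=> w; have [Rw|nRw] := pselect (regular w); last first.
    by near=> n; split => -[].
  have W0 i : 0 <= W i w by case: (Rw i).
  have D0 i : (0 < D i w)%N by case: (Rw i).
  have same : \forall n \near \oo, forall ij : 'I_S.+1 * 'I_r.+1,
      ((slot (V n) ij.1 w).+1%:R * h n < a ij.2) = (arr w ij.1 < a ij.2).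
    apply: filter_forall => -[i j] /=.
    (* Approximation from the right: an arrival at or after [a j] stays so for every step size,
       which includes [arr w i = a j]; one strictly before [a j] needs [h n] small. *)
    have [late|early] := leP (a j) (arr w i).
      apply: filterS h_gt0 => n hn.
      have /andP[+ _] := @slot_arrival _ _ T (h n) (fun i => W i : T -> R) w hn
        W0 i.
      by move=> sa; rewrite ltNge (le_trans late sa).
    have e0 : 0 < (a j - arr w i) / i.+1%:R by rewrite divr_gt0// subr_gt0.
    have hs : \forall n \near \oo, h n < (a j - arr w i) / i.+1%:R.
      exact: (cvgr_lt 0 h0).
    near=> n; have hn : 0 < h n by near: n.
    have /andP[_ sa] := @slot_arrival _ _ T (h n) (fun i => W i : T -> R) w hn
      W0 i.
    apply: le_lt_trans sa _; rewrite -ltrBrDl mulrC -ltr_pdivlMr//.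
    by near: n.
  near=> n; have hn : 0 < h n by near: n.
  have sm : forall i j, (i <= S)%N -> (j <= r)%N ->
      ((slot (V n) i w).+1%:R * h n < a j) = (arr w i < a j).
    move=> i j iS jr.
    have : forall ij : 'I_S.+1 * 'I_r.+1,
      ((slot (V n) ij.1 w).+1%:R * h n < a ij.2) = (arr w ij.1 < a ij.2) by
        near: n.
    by move=> /(_ (Ordinal (iS : (i < S.+1)%N), Ordinal (jr : (j < r.+1)%N))).
  have := @block_event_cells_mark _ _ T (h n) (fun i => W i : T -> R)
    (fun i => D i : T -> nat) a r w hn a0 a_nd W0 D0 kap sm.
  by rewrite /limit_event /B hn /= => -[H1 H2]; split => -[? ?]; split => //;
    [exact: H1|exact: H2].
apply: cvg_trans H; apply: near_eq_cvg; near=> n.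
have hn : 0 < h n by near: n.
rewrite pr_setI_regular// /B hn.
exact: (pr_block_event_exponential indepW indepD indepWD lawW lawD hn).
Unshelve. all: by end_near.
Qed.

End compound_poisson_limit.

(** * Convergence of expectations from point probabilities and tightness *)

Lemma cvg_sum_seq (R : realType) (E : Type) (S : seq E) (v : E -> nat -> R)
    (l : E -> R) : (forall e, v e n @[n --> \oo] --> l e) ->
  \sum_(e <- S) v e n @[n --> \oo] --> \sum_(e <- S) l e.
Proof.
move=> vl; elim: S => [|e S IH].
  by under eq_fun do rewrite big_nil; rewrite big_nil; exact: cvg_cst.
under eq_fun do rewrite big_cons; rewrite big_cons; exact: cvgD.
Qed.

Section countable_partition.
Variables (R : realType) (d : measure_display) (T : measurableType d).
Variables (P : probability T R) (E : eqType) (A : E -> set T).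
Hypothesis mA : forall e, measurable (A e).
Hypothesis disjA : forall e e' x, A e x -> A e' x -> e = e'.

Lemma integrable_bounded (G : T -> R) (M : R) : measurable_fun setT G ->
  (forall x, `|G x| <= M) -> P.-integrable setT (EFin \o G).
Proof.
move=> mG GM; apply: measurable_bounded_integrable => //.
  by rewrite (le_lt_trans (probability_le1 _ _)) ?ltry.
exists M; split; first exact: num_real.
by move=> x Mx y _; apply: le_trans (GM y) _; exact: ltW.
Qed.

Lemma integrable_step (c : R) (e : E) :
  P.-integrable setT (EFin \o (fun x => c * \1_(A e) x)).
Proof.
apply: (@integrable_bounded _ `|c|).
  by apply: measurable_funM => //; exact: measurable_indic.
move=> x; rewrite normrM ler_piMr// indicE; case: (_ \in _);
  by rewrite ?normr1 ?normr0.
Qed.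

Let remainder (F : E -> R) (G : T -> R) (S : seq E) (x : T) : R :=
  G x - \sum_(e <- S) F e * \1_(A e) x.

Lemma Rintegral_remainder (F : E -> R) (G : T -> R) (S : seq E) : P.-integrable
  setT (EFin \o G) ->
  P.-integrable setT (EFin \o remainder F G S) /\
  \int[P]_x remainder F G S x =
    \int[P]_x G x - \sum_(e <- S) F e * pr P (A e).
Proof.
move=> iG; elim: S => [|e S [iS IH]].
  rewrite big_nil subr0; split.
    by apply: eq_integrable iG => // x _ /=; rewrite /remainder big_nil subr0.
  by apply: eq_Rintegral => x _; rewrite /remainder big_nil subr0.
have rE x : remainder F G (e :: S) x = remainder F G S x - F e * \1_(A e) x.
  by rewrite /remainder big_cons; ring.
have ie := integrable_step (F e) e; split.
  rewrite (_ : _ \o _ = (EFin \o remainder F G S) \-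
      (EFin \o (fun x => F e * \1_(A e) x)%R))%E; first exact: integrableB.
  by apply/funext => x; rewrite /= rE EFinB.
have -> : \int[P]_x remainder F G (e :: S) x =
    \int[P]_x (remainder F G S x - F e * \1_(A e) x).
  by apply: eq_Rintegral => x _; exact: rE.
rewrite RintegralB// IH big_cons.
have -> : \int[P]_x (F e * \1_(A e) x) = F e * pr P (A e).
  rewrite RintegralZl//; last first.
    have := integrable_step 1 e; apply: eq_integrable => // x _ /=.
    by rewrite mul1r.
  by rewrite /Rintegral integral_indic// setIT.
by ring.
Qed.

(** The remainder vanishes on the chosen atoms, which are disjoint, and is at most [M] in modulus
    elsewhere. *)
Lemma Rintegral_partition_approx (F : E -> R) (G : T -> R) (S : seq E) (M : R)
  : uniq S ->
  measurable_fun setT G -> (forall x, `|G x| <= M) ->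
  (forall e x, A e x -> G x = F e) ->
  `|\int[P]_x G x - \sum_(e <- S) F e * pr P (A e)| <=
    M * (1 - \sum_(e <- S) pr P (A e)).
Proof.
move=> uS mG GM GF.
have [iD <-] := Rintegral_remainder F S (integrable_bounded mG GM).
have i1 : P.-integrable setT (EFin \o cst (1 : R)).
  by apply: (@integrable_bounded _ 1) => // x; rewrite normr1.
have [iC] := Rintegral_remainder (fun=> 1) S i1.
rewrite Rintegral_cst// [fine _](prT P) mulr1.
under eq_bigr do rewrite mul1r.
move=> <-; apply: le_trans (le_normr_Rintegral _ iD) _ => //.
rewrite -RintegralZl//; apply: le_Rintegral => //.
- by apply: integrable_norm.
- pose H := EFin \o remainder (fun=> 1) (cst 1) S.
  rewrite (_ : _ \o _ = (fun x => M%:E * H x)%E); first exact: integrableZl.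
  by apply/funext => x; rewrite /= EFinM.
move=> x _; rewrite /remainder.
have [[e eS Ae]|nA] := pselect (exists2 e, e \in S & A e x).
  have one (F' : E -> R) : \sum_(e' <- S) F' e' * \1_(A e') x = F' e.
    rewrite (bigD1_seq e)//= indicE mem_set// mulr1 big1 ?addr0// => e' ee'.
    rewrite indicE memNset ?mulr0// => Ae'.
    by move: ee'; rewrite (disjA Ae' Ae) eqxx.
  by rewrite !one (GF e)// !subrr normr0 mulr0.
have none (F' : E -> R) : \sum_(e' <- S) F' e' * \1_(A e') x = 0.
  rewrite big_seq big1// => e eS; rewrite indicE memNset ?mulr0// => Ae.
  by apply: nA; exists e.
by rewrite !none !subr0 mulr1.
Qed.

End countable_partition.

(** A finite set of atoms carries almost all the mass for all large [n], and on it only finitely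
    many probabilities have to converge; off it the integrands are controlled by [M]. *)
Lemma cvg_expectation (R : realType) (d d' : measure_display)
    (T : measurableType d) (T' : measurableType d')
    (P : probability T R) (P' : probability T' R) (E : eqType)
    (A : nat -> E -> set T) (B : E -> set T') (F : E -> R)
    (G : nat -> T -> R) (G' : T' -> R) (M : R) :
  (forall n e, measurable (A n e)) -> (forall e, measurable (B e)) ->
  (forall n e e' x, A n e x -> A n e' x -> e = e') ->
  (forall e e' x, B e x -> B e' x -> e = e') ->
  (forall e, pr P (A n e) @[n --> \oo] --> pr P' (B e)) ->
  (forall eps, 0 < eps -> exists2 S : seq E, uniq S &
     \forall n \near \oo, 1 - eps <= \sum_(e <- S) pr P (A n e)) ->
  (\forall n \near \oo, measurable_fun setT (G n) /\
     forall e x, A n e x -> G n x = F e) ->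
  (forall n x, `|G n x| <= M) ->
  measurable_fun setT G' -> (forall e x, B e x -> G' x = F e) ->
  (forall x, `|G' x| <= M) ->
  (\int[P]_x (G n x)%:E)%E @[n --> \oo] --> (\int[P']_x (G' x)%:E)%E.
Proof.
move=> mA mB dA dB AB tight GA GM mG' GB G'M.
have iG' : P'.-integrable setT (EFin \o G') by exact: integrable_bounded G'M.
have -> : (\int[P']_x (G' x)%:E = (\int[P']_x G' x)%:E)%E.
  by rewrite /Rintegral fineK//; exact: integrable_fin_num.
apply/fine_cvgP; split.
  near=> n; have [mGn _] : measurable_fun setT (G n) /\
     forall e x, A n e x -> G n x = F e by near: n.
  by apply: integrable_fin_num => //; apply: integrable_bounded (GM n).
have {}GM n x : `|G n x| <= `|M| by apply: le_trans (GM n x) _; exact: ler_norm.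
have {}G'M x : `|G' x| <= `|M| by apply: le_trans (G'M x) _; exact: ler_norm.
set C := `|M| in GM G'M; have C0 : 0 <= C by exact: normr_ge0.
apply/cvgrPdist_le => eps eps0.
have C1 : 0 < C + 1 by rewrite ltr_wpDl.
(* [C + 1] rather than [C], which may vanish; the mass off the atoms then costs at most
   [eps / 4]. *)
pose del := eps / (4 * (C + 1)).
have del0 : 0 < del by rewrite divr_gt0// mulr_gt0.
have Cdel : C * del <= eps / 4.
  rewrite /del mulrA ler_pdivrMr ?mulr_gt0// mulrACA.
  rewrite [leRHS](_ : _ = eps * (C + 1)); last by field.
  by rewrite [leLHS]mulrC ler_wpM2l ?lerDl// ltW.
have [S uS SA] := tight del del0.
have cA : \sum_(e <- S) pr P (A n e) @[n --> \oo] --> \sum_(e <- S) pr P' (B e).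
  by apply: cvg_sum_seq => e; exact: AB.
have cFA : \sum_(e <- S) F e * pr P (A n e) @[n --> \oo] -->
    \sum_(e <- S) F e * pr P' (B e).
  by apply: cvg_sum_seq => e; apply: cvgM; [exact: cvg_cst|exact: AB].
(* Tightness passes to the limit law, with the same finite set of atoms. *)
have SB : 1 - del <= \sum_(e <- S) pr P' (B e) by exact: cvgr_to_ge cA SA.
have HB := Rintegral_partition_approx P' mB dB uS mG' G'M GB.
have eps4 : 0 < eps / 4 by rewrite divr_gt0.
have /cvgrPdist_le/(_ _ eps4) FA := cFA.
near=> n.
have [mGn GFn] : measurable_fun setT (G n) /\
  forall e x, A n e x -> G n x = F e by near: n.
have HA := Rintegral_partition_approx P (mA n) (dA n) uS mGn (GM n) GFn.
have SAn : 1 - del <= \sum_(e <- S) pr P (A n e) by near: n.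
have near4 : `|\sum_(e <- S) F e * pr P' (B e) -
               \sum_(e <- S) F e * pr P (A n e)| <= eps / 4.
  by near: n.
have bound x : 1 - del <= x -> C * (1 - x) <= eps / 4.
  by move=> dx; apply: le_trans Cdel; apply: ler_wpM2l => //; lra.
have {}HA := le_trans HA (bound _ SAn); have {}HB := le_trans HB (bound _ SB).
apply: le_trans (ler_distD (\sum_(e <- S) F e * pr P' (B e)) _ _) _.
have -> : eps = eps / 4 + (eps / 4 + (eps / 4 + eps / 4)) by field.
apply: lerD => //.
apply: le_trans (ler_distD (\sum_(e <- S) F e * pr P (A n e)) _ _) _.
apply: lerD => //; rewrite distrC; apply: le_trans HA _.
by rewrite lerDl divr_ge0// ltW.
Unshelve. all: by end_near.
Qed.

Lemma nat_eseries_fin (R : realType) (v : nat -> nat) (n : nat) :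
  (forall i, (n <= i)%N -> v i = 0%N) ->
  (\sum_(i <oo) (v i)%:R%:E = (\sum_(i < n) v i)%:R%:E :> \bar R)%E.
Proof.
move=> v0; have p k : (0 <= k)%N -> (0%R <= (v k)%:R%:E :> \bar R)%E.
  by rewrite lee_fin ler0n.
rewrite (nneseries_split 0 n p) add0n eseries0; last by move=> i ni _;
  rewrite v0.
by rewrite adde0 sumEFin natr_sum big_mkord.
Qed.

(** Either the terms vanish eventually or the partial sums are unbounded. In both cases [fine]
    returns a natural number, 0 standing for infinity. *)
Lemma nat_eseries (R : realType) (v : nat -> nat) :
  (\sum_(i <oo) (v i)%:R%:E = +oo :> \bar R)%E \/
  exists n, (\sum_(i <oo) (v i)%:R%:E = n%:R%:E :> \bar R)%E.
Proof.
have [[n H]|H] := pselect (exists n, forall i, (n <= i)%N -> v i = 0%N).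
  by right; exists (\sum_(i < n) v i)%N; exact: nat_eseries_fin.
left; apply/eqP; rewrite -leye_eq leye_eq; apply/eqP/eqyP => A A0.
have unb k : exists n, (k <= \sum_(0 <= i < n) v i)%N.
  elim: k => [|k [n kn]]; first by exists 0%N.
  have [i ni vi] : exists2 i, (n <= i)%N & v i <> 0%N.
    apply: contrapT => nex; apply: H; exists n => i ni.
    by apply: contrapT => vi; apply: nex; exists i.
  exists i.+1; rewrite big_nat_recr//= (@big_cat_nat _ _ _ n)//=; lia.
have [n An] := unb (Num.truncn A).+1.
apply: le_trans (nneseries_lim_ge (P := xpredT) (m := 0%N) n _); last first.
  by move=> i _ _; rewrite lee_fin ler0n.
rewrite sumEFin lee_fin -natr_sum; apply: le_trans (ltW (truncnS_gt A)) _.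
by rewrite ler_nat.
Qed.

(** A preimage is a countable union of fibres of [Y], so [F] may be arbitrary: measurability of a
    test function of the counts reduces to that of the counts. *)
Lemma measurable_countable_comp (R : realType) (d : measure_display)
    (T : measurableType d) (E : countType) (Y : T -> E) (F : E -> R) :
  (forall e, measurable (Y @^-1` [set e])) -> measurable_fun setT (F \o Y).
Proof.
move=> mY _ B mB; rewrite setTI.
have -> : (F \o Y) @^-1` B = \bigcup_n
    (if unpickle n is Some e then
       if F e \in B then Y @^-1` [set e] else set0 else set0).
  apply/seteqP; split => x /=.
    by move=> Bx; exists (pickle (Y x)) => //=; rewrite pickleK mem_set.
  by move=> [n _]; case: unpickle => // e; case: ifPn => // /set_mem Be /= ->.
by apply: bigcup_measurable => n _; case: unpickle => // e; case: ifP.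
Qed.

(** * Sets of the ring as unions of cells *)

Section adapted_sets.
Variable R : realType.
Implicit Types (J : set R) (s : seq R).

(** [J] is a union of cells [[a j, a j.+1)] with [j < r], membership being read off at the left
    ends. Equal consecutive ends give empty cells, which impose nothing. *)
Definition adapted (a : nat -> R) (r : nat) (J : set R) : Prop :=
  (forall j x, (j < r)%N -> a j <= x < a j.+1 -> (J x <-> J (a j))) /\
  (forall x, J x -> 0 <= x < a r).

Lemma adapted_mem a r J x : a 0%N = 0 -> (forall j, a j <= a j.+1) ->
  adapted a r J -> 0 <= x ->
  ((x \in J) = \sum_(j < r) (a j \in J) * (a j <= x < a j.+1)%R :> nat)%N.
Proof.
move=> a0 a_nd [aJ Jr] x0.
rewrite (eq_bigr (fun j : 'I_r => (x \in J) * (a j <= x < a j.+1)%R)%N);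
  last first.
  move=> j _; have [xj|_] := boolP (a j <= x < a j.+1); last by rewrite !muln0.
  rewrite !muln1; congr nat_of_bool; apply/idP/idP => /set_mem H; apply/mem_set.
    exact/(aJ j x).
  exact/(aJ j x).
rewrite -big_distrr/= cells_partition//;
  have [/set_mem/Jr/andP[_ ->]//|] := boolP (x \in J).
by [].
Qed.

(** Membership depends only on the position relative to finitely many thresholds. For a union the
    lists are concatenated, so the intervals may overlap. *)
Let determined s J := [/\ forall c, c \in s -> 0 <= c,
  forall x y, (forall c, c \in s -> (c <= x) = (c <= y)) -> (J x <-> J y) &
  forall x, J x -> 0 <= x /\ exists2 c, c \in s & x < c].

Lemma determined_semiring J : semiringS J -> exists s, determined s J.
Proof.
move=> [b [c [b0 c0 ->]]]; exists [:: b; c]; split.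
- by move=> x; rewrite !inE => /orP[] /eqP->.
- move=> x y H; rewrite /= !in_itv/= !ltNge (H b) ?(H c)//;
  rewrite !inE eqxx ?orbT//.
- move=> x; rewrite /= in_itv/= => /andP[bx xc]; split;
  first exact: le_trans bx.
  by exists c => //; rewrite !inE eqxx orbT.
Qed.

Lemma determined_ring J : ringR J -> exists s, determined s J.
Proof.
move=> [m [I [sI ->]]].
have /choice[s Hs] : forall j, exists s, determined s (I j).
  by move=> j; exact: determined_semiring.
exists (flatten [seq s j | j <- enum 'I_m]).
have sub j c : c \in s j -> c \in flatten [seq s j | j <- enum 'I_m].
  by move=> cs; apply/flatten_mapP; exists j => //; rewrite mem_enum.
split.
- by move=> c /flatten_mapP[j _ cj]; have [+ _ _] := Hs j; exact.
- move=> x y H; have E j : I j x <-> I j y.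
    have [_ + _] := Hs j; apply => c /sub; exact: H.
  by split=> -[j _ ?]; exists j => //; exact/E.
- move=> x [j _ Ix]; have [_ _ /(_ x Ix)[x0 [c cj xc]]] := Hs j.
  by split=> //; exists c => //; exact: sub cj.
Qed.

Lemma ring_adapted (m : nat) (J : 'I_m -> set R) : (forall l, ringR (J l)) ->
  exists r a, [/\ a 0%N = 0, forall j, a j <= a j.+1 &
    forall l, adapted a r (J l)].
Proof.
move=> rJ; have /choice[s Hs] : forall l, exists s, determined s (J l).
  by move=> l; exact: determined_ring.
pose t := sort <=%R (0 :: flatten [seq s l | l <- enum 'I_m]).
have tP c : (c \in t) = (c == 0) || (c \in flatten [seq s l | l <- enum 'I_m]).
  by rewrite mem_sort inE.
have sub l c : c \in s l -> c \in t.
  move=> cs; rewrite tP; apply/orP; right.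
  by apply/flatten_mapP; exists l => //; rewrite mem_enum.
have t0 c : c \in t -> 0 <= c.
  rewrite tP => /orP[/eqP->//|/flatten_mapP[l _ cl]].
  by have [+ _ _] := Hs l; exact.
have st : sorted <=%R t by apply: sort_sorted; exact: le_total.
pose r := (size t).-1; have szt : size t = r.+1 by rewrite /r size_sort.
(* Frozen beyond [r]: the default 0 of [nth] would break monotonicity there. *)
pose a j := nth 0 t (minn j r).
have aP i j : (i <= j)%N -> a i <= a j.
  move=> ij; apply: (sorted_leq_nth le_trans le_refl) => //.
  - by rewrite inE szt ltnS geq_minr.
  - by rewrite inE szt ltnS geq_minr.
  - lia.
have ta c : c \in t -> exists2 i, (i <= r)%N & c = a i.
  move=> ct; exists (index c t); first by rewrite -ltnS -szt index_mem.
  rewrite /a (minn_idPl _) ?nth_index//.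
  by rewrite -ltnS -szt index_mem.
have at_ i : a i \in t by rewrite mem_nth// szt ltnS geq_minr.
exists r, a; split=> [|j|l]; last split.
- apply/eqP; rewrite eq_le t0// andbT.
  have [|i _ ->] := ta 0; first by rewrite tP eqxx.
  exact: aP.
- exact: aP.
- move=> j x jr /andP[jx xj]; have [_ H _] := Hs l;
  apply: H => c /sub/ta[i ir ->].
  have [ij|ji] := leqP i j.
    by rewrite aP// (le_trans (aP _ _ ij) jx).
  have xi := lt_le_trans xj (aP _ _ ji).
  by rewrite !leNgt xi (le_lt_trans jx xi).
- move=> x Jx; have [_ _ /(_ x Jx)[-> [c /sub/ta[i ir ->] xc]]] := Hs l.
  exact: lt_le_trans (aP _ _ ir).
Qed.

Lemma ringR_measurable J : ringR J -> measurable J.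
Proof.
move=> [m [I [sI ->]]]; apply: fin_bigcup_measurable => // j _.
by have [b [c [_ _ ->]]] := sI j; exact: measurable_itv.
Qed.

End adapted_sets.

(** * Counts of the limit process *)

Section compound_poisson_counts.
Variables (R : realType) (d : measure_display) (T : measurableType d).
Variables (P : probability T R).
Variables (W : nat -> {RV P >-> R}) (D : nat -> {RV P >-> nat}).
Variable N : set R -> T -> \bar R.
Hypothesis NE : forall (J : set R) w, measurable J -> N J w =
  (\int[mseries (fun i => mscale (NngNum (ler0n R (D i w)))
     (\d_(arrival (fun j => W j w) i))) 0]_y (\1_J y)%:E)%E.

Local Notation arr w := (arrival (fun j => W j w)).

Lemma count_eseries J w : measurable J ->
  (N J w = \sum_(i <oo) ((arr w i \in J) * D i w)%N%:R%:E)%E.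
Proof.
move=> mJ; rewrite NE// integral_indic// setIT /mseries.
apply: eq_eseriesr => i _.
transitivity ((D i w)%:R%:E * (dirac (arr w i) J : \bar R))%E; first by [].
by rewrite diracE -EFinM -natrM mulnC.
Qed.

(** On this event the points of index beyond [S] lie past [a r], so the series is a finite sum,
    which regroups by cells. *)
Lemma count_limit_event (a : nat -> R) (r : nat) (kap : nat -> nat) J w :
  a 0%N = 0 -> (forall j, a j <= a j.+1) -> measurable J -> adapted a r J ->
  limit_event W D a r kap w ->
  N J w = (\sum_(j < r) (a j \in J) * kap j)%N%:R%:E.
Proof.
move=> a0 a_nd mJ aJ [[late cnt] reg];
  set S := (\sum_(j < r) kap j)%N in late cnt.
have W0 i : 0 <= W i w by case: (reg i).
have arr0 : 0 <= arr w 0%N 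
  by exact: (@arrival0_ge0 _ _ T (fun i => W i : T -> R) w W0).
have arrS i : arr w i <= arr w i.+1 
  by exact: (@arrival_nd _ _ T (fun i => W i : T -> R) w W0).
rewrite count_eseries// (@nat_eseries_fin _ _ S.+1); last first.
  move=> i Si; case: (boolP (_ \in J)) => // /set_mem Ji.
  have [_ /(_ _ Ji)/andP[_]] := aJ; rewrite ltNge.
  by rewrite (le_trans late)// (le_arr arrS)// ltnW.
congr (_%:R%:E).
under eq_bigr do rewrite (adapted_mem a0 a_nd aJ (le_trans arr0 (le_arr arrS
  (leq0n _)))).
under eq_bigr do rewrite big_distrl/=.
rewrite exchange_big/=; apply: eq_bigr => j _.
rewrite -(cnt j (ltn_ord j)) /early_count big_distrr/=.
by apply: eq_bigr => i _; rewrite mulnA.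
Qed.

Lemma fine_count J w : measurable J -> exists n, fine (N J w) = n%:R.
Proof.
move=> mJ; rewrite count_eseries//.
by case: (nat_eseries R (fun i => (arr w i \in J) * D i w)%N) => [->|[n ->]];
  [exists 0%N|exists n].
Qed.

Lemma measurable_count J : measurable J -> measurable_fun setT (N J).
Proof.
move=> mJ.
have -> : N J = fun w => (\sum_(i <oo) ((arr w i \in J) * D i w)%N%:R%:E)%E.
  by apply/funext => w; exact: count_eseries.
apply: ge0_emeasurable_sum => i; first by move=> w _ _; rewrite lee_fin ler0n.
move=> _; apply/measurable_EFinP.
pose Y w : bool * nat := (arr w i \in J, D i w : nat).
rewrite (_ : (fun w => _) = (fun e : bool * nat => (e.1 * e.2)%N%:R) \o Y)//.
apply: measurable_countable_comp => -[b k].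
have mA : measurable [set w | J (arr w i)].
  by have := measurable_arrival W i measurableT mJ; rewrite setTI.
rewrite (_ : _ @^-1` _ = (if b then [set w | J (arr w i)] else ~` [set w | J
  (arr w i)])
    `&` D i @^-1` [set k]).
  apply: measurableI; last exact: measurable_preimageD.
  by case: b => //; exact: measurableC.
apply/seteqP; split => w; rewrite /Y /=.
  by move=> [<- <-]; split => //; case: ifPn => [/set_mem//|/negP nJ ?];
    apply: nJ; exact: mem_set.
by move=> [+ ->]; case: b => ?; congr pair; [exact: mem_set|exact: memNset].
Qed.

(** [truncn] recovers the counts as natural numbers, so that the function factors through a
    countable type. *)
Lemma measurable_count_fun (m : nat) (J : 'I_m -> set R) (g : 'rV[R]_m -> R) :
  (forall l, measurable (J l)) ->
  measurable_fun setT (fun w => g (\row_l fine (N (J l) w))).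
Proof.
move=> mJ; pose Y w : {ffun 'I_m -> nat} := [ffun l => Num.truncn (fine (N (J
  l) w))].
pose F (e : {ffun 'I_m -> nat}) := g (\row_l (e l)%:R).
have FE : (fun w => g (\row_l fine (N (J l) w))) = F \o Y.
  apply/funext => w; rewrite /F /=; congr g; apply/rowP => l.
  by rewrite !mxE ffunE; have [n ->] := fine_count w (mJ l); rewrite natrK.
rewrite FE; apply: measurable_countable_comp => e.
rewrite (_ : _ @^-1` _ = \bigcap_(l in setT) [set w | fine (N (J l) w) = (e
  l)%:R]).
  apply: fin_bigcap_measurable => // l _.
  have mfN : measurable_fun setT (fun w => fine (N (J l) w)).
    by apply: measurableT_comp;
      [exact: fine_measurable|exact: measurable_count].
  by have := mfN measurableT _ (measurable_set1 ((e l)%:R : R)); rewrite setTI.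
apply/seteqP; split => w; rewrite /Y /=.
  by move=> <- l _; rewrite /= ffunE; have [n ->] := fine_count w (mJ l);
    rewrite natrK.
by move=> H; apply/ffunP => l; rewrite ffunE (H l I) natrK.
Qed.

End compound_poisson_counts.

(** * Counts of exceedances over integer intervals *)

Section counting_exceedances.
Variables (R : realType) (d : measure_display) (T : measurableType d).
Variables (f : T -> T) (phi : T -> \bar R).
Variable u : \bar R.
Local Notation exceed := (exceed f phi u).

Lemma count_exceed_eseries (A : set R) x : (count_exceed f phi u A x =
  \sum_(i <oo) ((i%:R \in A) * exceed i x)%N%:R%:E)%E.
Proof.
rewrite /count_exceed eseries_mkcond; apply: eq_eseriesr => i _.
rewrite indicE; case: ifP => iA; last by rewrite mul0n.
rewrite mul1n; congr (_%:R%:E); congr nat_of_bool.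
by apply/idP/idP => [/set_mem|?]; [|apply/mem_set].
Qed.

Lemma count_exceed_itv a b x : (count_exceed f phi u `[a%:R, b%:R[ x =
  (\sum_(a <= t < b) exceed t x)%N%:R%:E)%E.
Proof.
rewrite count_exceed_eseries (@nat_eseries_fin _ _ b); last first.
  by move=> i bi; rewrite memNset//= in_itv/= !ltr_nat ltnNge bi andbF.
congr (_%:R%:E); rewrite -(big_mkord xpredT
  (fun i => (i%:R \in `[a%:R, b%:R[%classic) * exceed i x)%N).
rewrite [RHS](big_nat_widenl _ 0)// [RHS]big_mkcond/=.
apply: eq_big_nat => i /andP[_ ib].
rewrite (_ : (_ \in _) = (a <= i)%N); first by case: (a <= i)%N;
  rewrite ?mul1n ?mul0n.
apply/idP/idP => [/set_mem|ai].
  by rewrite /= in_itv/= ler_nat => /andP[].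
by apply/mem_set; rewrite /= in_itv/= ler_nat ltr_nat ai.
Qed.

(** The block recursion unfolded into one condition per interval, the form in which D is stated. *)
Lemma block_event_nth (xi : nat -> T -> nat) s (L : seq (nat * nat)) x
  (b := fun j => (s + \sum_(i < j) (nth (0, 0)%N L i).1)%N) :
  block_event xi s L x <-> forall j, (j < size L)%N ->
    (\sum_(b j <= t < b j.+1) xi t x = (nth (0, 0)%N L j).2)%N.
Proof.
rewrite /b {b}; elim: L s => [|[m k] L IH] s; first by split.
have sh j : (\sum_(i < j.+1) (nth (0, 0) ((m, k) :: L) i).1 =
    m + \sum_(i < j) (nth (0, 0) L i).1)%N by rewrite big_ord_recl.
rewrite [block_event _ _ _]/=; split=> [[E /IH H] [|j] jL|H].
- by rewrite sh !big_ord0 !addn0.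
- by have := H j jL; rewrite !sh !addnA.
- split; first by have := H 0%N isT; rewrite sh !big_ord0 !addn0.
  by apply/IH => j jL; have := H j.+1 jL; rewrite !sh !addnA.
Qed.

End counting_exceedances.

(** The upper bound on [expR (- x)] comes from [(1 - x + x^2)(1 + x) = 1 + x^3]. With [x = theta h]
    the quadratic error is repeated O(1/h) times, so it is negligible. *)
Lemma one_minus_expR_approx (R : realType) (x : R) : 0 <= x ->
  `|1 - expR (- x) - x| <= x ^+ 2.
Proof.
move=> x0; have H1 := expR_ge1Dx (- x); have H2 := expR_ge1Dx x.
have E : expR (- x) <= (1 + x)^-1.
  by rewrite expRN lef_pV2 ?posrE ?expR_gt0//; lra.
have E2 : (1 + x)^-1 <= 1 - x + x ^+ 2.
  rewrite -[leLHS]mul1r ler_pdivrMr; last lra.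
  rewrite [leRHS](_ : _ = 1 + x ^+ 3); last by ring.
  by rewrite lerDl exprn_ge0.
by rewrite ler_norml; apply/andP; split; have := sqr_ge0 x; lra.
Qed.

(** * From D, D' and the choice of levels to vanishing errors *)

Section exceedance_limit.
Variables (R : realType) (d : measure_display) (T : measurableType d).
Variables (P : probability T R) (f : T -> T) (phi : T -> \bar R) (p : nat).
Variables (theta tau : R) (u : nat -> R) (t : nat -> nat).
Hypotheses (mf : measurable_fun setT f) (mphi : measurable_fun setT phi).
Hypothesis Pinv : forall A, measurable A -> P (f @^-1` A) = P A.
Hypothesis theta01 : 0 < theta < 1.
Hypothesis p_gt0 : (0 < p)%N.
Local Notation h n := (pr P (U phi (u n)%:E)).
Hypothesis no_early_return : \forall n \near \oo, forall i x, (0 < i < p)%N ->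
  U phi (u n)%:E x -> ~ U phi (u n)%:E (iter i f x).
Hypothesis pr_Ukappa_asymp : forall k,
  pr P (Ukappa f phi p k (u n)%:E) / ((1 - theta) ^+ k * h n)
    @[n --> \oo] --> (1 : R).
Hypothesis tau_gt0 : 0 < tau.
Hypothesis u_level : n%:R * h n @[n --> \oo] --> tau.
Hypothesis Dp : condition_Dp P f phi p u t.
Hypothesis Dp' : condition_Dp' P f phi p u t.

Lemma near_nat_gt0 : \forall n \near \oo, (0 < n)%N.
Proof. exact: nbhs_infty_gt. Qed.

Lemma level_gt0 : \forall n \near \oo, 0 < h n.
Proof.
have : \forall n \near \oo, 0 < n%:R * h n by exact: (cvgr_gt _ u_level).
apply: filterS => n nh; rewrite lt_neqAle pr_ge0 andbT eq_sym.
by apply: contraTneq nh => ->; rewrite mulr0 ltxx.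
Qed.

(** Since [n h -> tau > 0], an o(1/n) is an o(h). *)
Lemma cvg_div_level (x : nat -> R) :
  n%:R * x n @[n --> \oo] --> 0 -> x n / h n @[n --> \oo] --> 0.
Proof.
move=> nx; have H : (n%:R * x n) * (n%:R * h n)^-1 @[n --> \oo] --> 0 * tau^-1.
  by apply: cvgM => //; apply: cvgV => //; rewrite gt_eqF.
rewrite mul0r in H; apply: cvg_trans H; apply: near_eq_cvg.
near=> n; have n0 : (n%:R : R) != 0 by rewrite pnatr_eq0 -lt0n; near: n;
  exact: near_nat_gt0.
have hn : h n != 0 by rewrite gt_eqF//; near: n; exact: level_gt0.
by field; rewrite n0 hn.
Unshelve. all: by end_near.
Qed.

Lemma cvg_level : h n @[n --> \oo] --> 0.
Proof.
have H : (n%:R * h n) * n.+1%:R^-1 @[n --> \oo] --> tau * 0.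
  by apply: cvgM => //; exact: cvg_harmonic.
rewrite mulr0 in H.
(* The splitting [h = n h / (n + 1) + h / (n + 1)] avoids a division by [n = 0]; [h <= 1] settles
   the second term. *)
have H2 : n%:R * h n * n.+1%:R^-1 + h n * n.+1%:R^-1 @[n --> \oo] --> 0 + 0.
  apply: cvgD => //; apply: (@squeeze_cvgr _ _ _ _ (cst 0) (fun n =>
    n.+1%:R^-1)).
  - apply: nearW => n; have hn := pr_ge0 P (U phi (u n)%:E).
    rewrite mulr_ge0//= ler_piMl// pr_le1//.
    exact: measurable_U mphi.
  - exact: cvg_cst.
  - exact: cvg_harmonic.
rewrite addr0 in H2; apply: cvg_trans H2; apply: near_eq_cvg.
apply: nearW => n; rewrite -mulrDl -[X in _ + X]mul1r -mulrDl natr1.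
by rewrite mulrAC divff ?mul1r// pnatr_eq0.
Qed.

(** Blocks are half-open intervals with integer ends that start at [g + 1 >= t n]; monotonicity of
    [gamma] replaces this distance by [t n]. *)
Lemma decorrelation_block_event : exists gam : nat -> R,
  n%:R * gam n @[n --> \oo] --> 0 /\
  forall n g j L, (1 <= n)%N -> (t n <= g.+1)%N ->
   `|pr P (Q f phi p j 0 (u n)%:E `&` block_event (exceed f phi (u n)%:E) g.+1
     L) -
     pr P (Q f phi p j 0 (u n)%:E) *
     pr P (block_event (exceed f phi (u n)%:E) g.+1 L)| <= gam n.
Proof.
have [gamma [H gam_ni t1 _ gam0]] := Dp.
exists (fun n => gamma n (t n)); split=> // n g j L n1 tg.
apply: le_trans (gam_ni n (t n) g.+1 _); last by rewrite t1.
pose b i := (g.+1 + \sum_(l < i) (nth (0, 0)%N L l).1)%N.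
pose J (i : 'I_(size L)) : set R := `[(b i)%:R, (b i.+1)%:R[%classic.
have sI i : semiringS (J i) by exists (b i)%:R, (b i.+1)%:R.
have lI : lbound (\bigcup_i J i) g.+1%:R.
  move=> x [i _]; rewrite /J /= in_itv/= => /andP[bx _].
  by apply: le_trans bx; rewrite ler_nat leq_addr.
have := H g.+1 n j _ J (fun i => (nth (0, 0)%N L i).2) isT n1 sI lI.
rewrite /= (_ : \bigcap_i _ = block_event (exceed f phi (u n)%:E) g.+1 L)//.
apply/seteqP; split => x.
  move=> Hx; apply/block_event_nth => i iL.
  by have := Hx (Ordinal iL) I; rewrite /J /= count_exceed_itv => -[/eqP];
    rewrite eqr_nat => /eqP.
move=> /block_event_nth Hx i _ /=; rewrite /J count_exceed_itv.
by congr (_%:R%:E); exact: Hx.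
Qed.

(** In [g = t n + (K + 1) p] the first summand serves D and the second contains the clusters. Then
    [g h -> 0] because [t n = o(n)], and eventually [g <= n / k n] because [k n * t n = o(n)], so
    the sum in D' dominates. *)
Lemma gap_exists (K : nat) : exists g : nat -> nat,
  [/\ forall n, (t n <= (g n).+1)%N, forall n, (K.+1 * p <= g n)%N,
     (g n)%:R * h n @[n --> \oo] --> 0 &
     exists del : nat -> R, n%:R * del n @[n --> \oo] --> 0 /\
       \forall n \near \oo, \sum_(1 <= i < (g n).+1)
  pr P (Q f phi p 0 0 (u n)%:E `&` iter i f @^-1` U phi (u n)%:E) <= del n].
Proof.
have [gamma [_ _ t1 tn0 _]] := Dp; have [k [koo kt0 sum0]] := Dp'.
pose c := (K.+1 * p)%N; exists (fun n => (t n + c)%N); split.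
- by move=> n; rewrite leqW// leq_addr.
- by move=> n; rewrite leq_addl.
- have H : (t n)%:R / n%:R * (n%:R * h n) + c%:R * h n @[n --> \oo] --> 0 * tau
  + c%:R * 0.
    apply: cvgD; first exact: cvgM tn0 u_level.
    by apply: cvgM cvg_level; exact: cvg_cst.
  rewrite mul0r mulr0 addr0 in H; apply: cvg_trans H; apply: near_eq_cvg.
  near=> n; have n0 : (n%:R : R) != 0.
    by rewrite pnatr_eq0 -lt0n; near: n; exact: near_nat_gt0.
  by rewrite natrD; field.
exists (fun n => \sum_(1 <= j < (n %/ k n).+1)
  pr P (Q f phi p 0 0 (u n)%:E `&` [set x | ((u n)%:E < Xproc f phi j x)%E])).
split; first exact: sum0.
(* As [t n >= 1], one has [t n + c <= c.+1 * t n]; hence [k n * t n < n / c.+1] makes the gap fit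
   below [n / k n]. *)
have c0 : 0 < (c.+1%:R : R)^-1 by rewrite invr_gt0.
have kt : \forall n \near \oo, (k n * t n)%:R / n%:R < (c.+1%:R : R)^-1.
  exact: (cvgr_lt _ kt0).
have kpos : \forall n \near \oo, (0 < k n)%N := koo _ (nbhs_infty_gt 0%N).
near=> n; have n0 : (0 < n)%N by near: n; exact: near_nat_gt0.
have k0 : (0 < k n)%N by near: n.
have H : (k n * t n)%:R / n%:R < (c.+1%:R : R)^-1 by near: n.
have gk : (t n + c <= n %/ k n)%N.
  rewrite leq_divRL//.
  rewrite ltr_pdivrMr ?ltr0n// mulrC ltr_pdivlMr ?ltr0n// -natrM ltr_nat in H.
  apply: leq_trans (ltnW H); rewrite mulnC -mulnA leq_pmul2l// mulnS leq_add2l.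
  by rewrite -[leqLHS]mul1n leq_mul2r t1 orbT.
rewrite [leRHS](@big_cat_nat _ _ _ (t n + c).+1)//= lerDl.
by apply: sumr_ge0 => i _; exact: pr_ge0.
Unshelve. all: by end_near.
Qed.

(** The annulus is a difference of two nested sets, and [(1 - theta)^j - (1 - theta)^(j + 1) = theta
    (1 - theta)^j]. *)
Lemma pr_Q_asymp j :
  (pr P (Q f phi p j 0 (u n)%:E) - theta * (1 - theta) ^+ j * h n) / h n
    @[n --> \oo] --> 0.
Proof.
have /andP[t0 t1] := theta01.
have q0 : 1 - theta != 0 by rewrite gt_eqF// subr_gt0.
have lim k : (1 - theta) ^+ k * (pr P (Ukappa f phi p k (u n)%:E) /
    ((1 - theta) ^+ k * h n)) @[n --> \oo] --> (1 - theta) ^+ k * 1.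
  by apply: cvgM; [exact: cvg_cst|exact: pr_Ukappa_asymp].
have H := cvgB (cvgB (lim j) (lim j.+1)) (cvg_cst (theta * (1 - theta) ^+ j)).
have Z : (1 - theta) ^+ j * 1 - (1 - theta) ^+ j.+1 * 1 -
  theta * (1 - theta) ^+ j = 0 by rewrite exprS; ring.
rewrite {}Z in H; pose y k n : R := (1 - theta) ^+ k *
  (pr P (Ukappa f phi p k (u n)%:E) / ((1 - theta) ^+ k * h n)).
have {}H : y j n - y j.+1 n - theta * (1 - theta) ^+ j @[n --> \oo] --> (0 : R).
  exact: H.
apply: cvg_trans H; apply: near_eq_cvg; near=> n.
have hn : h n != 0 by rewrite gt_eqF//; near: n; exact: level_gt0.
rewrite pr_Q// /y; field.
by rewrite hn !(expf_neq0 _ q0).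
Unshelve. all: by end_near.
Qed.

(** In the proof [e n] is the local error divided by [h]. The window has at most [a r / h] times, so
    their errors add up to [a r] times a null sequence, while the [r] gaps cost O(g h). *)
Lemma block_event_asymp (a : nat -> R) (r : nat) (kap : nat -> nat) :
  a 0%N = 0 -> (forall j, a j <= a j.+1) ->
  pr P (block_event (exceed f phi (u n)%:E) 0 (cell_blocks a r (h n) kap)) -
    renewal_prob (geometric_pmf theta) (1 - expR (- theta * h n))
      (cell_blocks a r (h n) kap) @[n --> \oo] --> (0 : R).
Proof.
move=> a0 a_nd; pose K := (\sum_(j < r) kap j)%N.
have /andP[t0 t1] := theta01.
have [gam [gam0 dec]] := decorrelation_block_event.
have [g [tg Kg gh [del [del0 second]]]] := gap_exists K.
pose eta n : R := \sum_(j < K.+1)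
  `|pr P (Q f phi p j 0 (u n)%:E) - theta * (1 - theta) ^+ j * h n|.
pose e n : R := K.+1%:R * (del n / h n + gam n / h n + eta n / h n + (g n)%:R *
  h n).
pose bound n : R := r%:R * (2 * ((g n)%:R * h n)) + a r * (2 * e n + theta ^+ 2
  * h n).
have hc := cvg_level.
have eta0 : eta n / h n @[n --> \oo] --> (0 : R).
  have -> : (0 : R) = \sum_(j <- index_enum 'I_K.+1) `|0 : R| by rewrite normr0
    big1.
  pose y (j : 'I_K.+1) n := `|(pr P (Q f phi p j 0 (u n)%:E) -
     theta * (1 - theta) ^+ j * h n) / h n|.
  have H : \sum_(j <- index_enum 'I_K.+1) y j n @[n --> \oo] -->
      \sum_(j <- index_enum 'I_K.+1) `|0 : R|.
    by apply: cvg_sum_seq => j; apply: cvg_norm; exact: pr_Q_asymp.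
  apply: cvg_trans H; apply: near_eq_cvg; near=> n.
  have hn : 0 < h n by near: n; exact: level_gt0.
  rewrite /eta mulr_suml; apply: eq_bigr => j _.
  by rewrite /y normrM normfV (gtr0_norm hn).
have e0 : e n @[n --> \oo] --> (0 : R).
  have -> : (0 : R) = K.+1%:R * (0 + 0 + 0 + 0) by rewrite !addr0 mulr0.
  apply: cvgM; first exact: cvg_cst.
  apply: cvgD gh; apply: cvgD eta0.
  by apply: cvgD; exact: cvg_div_level.
have b0 : bound n @[n --> \oo] --> (0 : R).
  have -> : (0 : R) = r%:R * (2 * 0) + a r * (2 * 0 + theta ^+ 2 * 0).
    by rewrite !mulr0 addr0 mulr0 addr0.
  apply: cvgD; apply: cvgM; try exact: cvg_cst.
    by apply: cvgM gh; exact: cvg_cst.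
  by apply: cvgD; apply: cvgM => //; exact: cvg_cst.
apply: (@squeeze_cvgr _ _ _ _ (fun n => - bound n) bound) => //; last first.
  by rewrite -oppr0; exact: cvgN.
near=> n; rewrite -ler_norml.
have hn : 0 < h n by near: n; exact: level_gt0.
have n0 : (0 < n)%N by near: n; exact: near_nat_gt0.
have Qn j : (j <= K)%N ->
    `|pr P (Q f phi p j 0 (u n)%:E) - theta * (1 - theta) ^+ j * h n| <= eta n.
  move=> jK; rewrite /eta (bigD1 (Ordinal (jK : (j < K.+1)%N)))//= lerDl.
  exact: sumr_ge0.
have early : forall i x, (0 < i < p)%N ->
  U phi (u n)%:E x -> ~ U phi (u n)%:E (iter i f x) by near: n.
have dn : \sum_(1 <= i < (g n).+1)
  pr P (Q f phi p 0 0 (u n)%:E `&` iter i f @^-1` U phi (u n)%:E) <= del n.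
  by near: n.
have rho01 := exponential_rate01 t0 hn.
apply: le_trans (block_event_renewal mf mphi Pinv theta01 p_gt0 early Qn
  (fun j L _ => dec n (g n) j L n0 (tg n)) dn (Kg n) rho01 _) _.
  apply/allP => mk /mapP[j]; rewrite mem_iota add0n => /andP[_ jr] -> /=.
  by rewrite /K (bigD1 (Ordinal jr))//= leq_addr.
rewrite size_mkseq sum_cell_blocks// /bound.
have -> : r%:R * (2 * h n * (g n)%:R) = r%:R * (2 * ((g n)%:R * h n)) by ring.
rewrite lerD2l.
set Y := (Y in _ * Y <= _).
have del_ge0 : 0 <= del n.
  by apply: le_trans dn; apply: sumr_ge0 => i _; exact: pr_ge0.
have gam_ge0 : 0 <= gam n.
  exact: le_trans (normr_ge0 _) (dec n (g n) 0%N [::] n0 (tg n)).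
have eta_ge0 : 0 <= eta n by exact: sumr_ge0.
have Y0 : 0 <= Y.
  by rewrite /Y addr_ge0// !mulr_ge0// !addr_ge0// !mulr_ge0// ltW.
have Yle : Y <= h n * (2 * e n + theta ^+ 2 * h n).
  rewrite [leRHS](_ : _ = 2 * (K.+1%:R * (del n + gam n + eta n +
     h n * ((g n)%:R * h n))) + (theta * h n) ^+ 2); last first.
    by rewrite /e; field; rewrite gt_eqF.
  rewrite /Y lerD2l mulNr; apply: one_minus_expR_approx.
  by rewrite mulr_ge0// ltW.
apply: le_trans (ler_wpM2r Y0 (cell_index_le a0 a_nd r hn)) _.
rewrite -mulrA; apply: ler_wpM2l; first exact: cells_ge0.
by rewrite mulrC ler_pdivrMr// mulrC.
Unshelve. all: by end_near.
Qed.

End exceedance_limit.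

(** * Cell counts of exceedances and their tightness *)

Section exceedance_cells.
Variables (R : realType) (d : measure_display) (T : measurableType d).
Variables (P : probability T R) (f : T -> T) (phi : T -> \bar R) (u : \bar R).
Hypotheses (mf : measurable_fun setT f) (mphi : measurable_fun setT phi).
Hypothesis Pinv : forall A, measurable A -> P (f @^-1` A) = P A.
Local Notation exceed := (exceed f phi u).
Local Notation h := (pr P (U phi u)).
Variables (a : nat -> R) (r : nat).
Hypotheses (a0 : a 0%N = 0) (a_nd : forall j, a j <= a j.+1).
Hypothesis h_gt0 : 0 < h.
Local Notation k j := (cell_index h (a j)).

(** The cut-off loses no point of a cell: [t h < a r] forces [t <= cell_index h (a r)]. *)
Definition cell_count (j : nat) (x : T) : nat :=
  (\sum_(0 <= t < (k r).+1) (a j <= t%:R * h < a j.+1)%R * exceed t x)%N.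

Lemma le_cell_index_last j : (j <= r)%N -> (k j <= k r)%N.
Proof.
move=> jr; apply: (homo_leq leqnn leq_trans (f := fun j => k j)) => // i.
exact: le_cell_index.
Qed.

Lemma count_exceed_cells (J : set R) x : adapted a r J ->
  (count_exceed f phi u [set h^-1 * y | y in J]%R x =
   (\sum_(j < r) (a j \in J) * cell_count j x)%N%:R%:E)%E.
Proof.
move=> aJ; set hJ := [set _ | _ in _]; rewrite count_exceed_eseries.
have scale i : (i%:R \in hJ) = (i%:R * h \in J).
  apply/idP/idP => /set_mem H; apply/mem_set.
    by case: H => y Jy <-; rewrite mulrAC mulVf ?mul1r// gt_eqF.
  by exists (i%:R * h) => //; rewrite mulrCA mulVf ?mulr1// gt_eqF.
rewrite (@nat_eseries_fin _ _ (k r).+1); last first.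
  move=> i ki; rewrite scale; case: (boolP (_ \in J)) => // /set_mem Ji.
  have [_ /(_ _ Ji)/andP[_]] := aJ.
  case: i ki {Ji} => // i ki; rewrite -cell_indexP ?cells_ge0//.
  by rewrite ltnNge -ltnS ki.
congr (_%:R%:E); rewrite -(big_mkord xpredT
  (fun i => (i%:R \in hJ) * exceed i x)%N).
rewrite (eq_bigr (fun i => \sum_(j < r)
    (a j \in J) * ((a j <= i%:R * h < a j.+1)%R * exceed i x))%N).
  by rewrite exchange_big/=; apply: eq_bigr => j _; rewrite -big_distrr.
move=> i _; rewrite scale (adapted_mem a0 a_nd aJ) ?mulr_ge0// 1?ltW//.
by rewrite big_distrl/=; apply: eq_bigr => j _; rewrite mulnA.
Qed.

(** [cell_index] counts the [t] with [(t + 1) h] before a cell end, so the times of a cell are those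
    of its block shifted by one. Stationarity absorbs the shift; time 0 has no counterpart and costs
    [h] in the comparison that follows. *)
Lemma cell_count_block j x : (j < r)%N -> ~ U phi u x ->
  cell_count j x = (\sum_(1 + k j <= t < 1 + k j.+1) exceed t x)%N.
Proof.
move=> jr /(exceedN f phi u 0) U0.
rewrite /cell_count big_nat_recl//= U0 muln0 add0n !add1n big_add1/=.
rewrite [RHS](big_nat_widen _ _ (k r)); last exact: le_cell_index_last.
rewrite [RHS](big_nat_widenl _ 0)// [RHS]big_mkcond/=; apply: eq_bigr => t _.
rewrite -cell_indexP ?cells_ge0// andbC leNgt -cell_indexP ?cells_ge0// -leqNgt.
by case: (_ && _); rewrite ?mul1n ?mul0n.
Qed.

Lemma measurable_cell_count j i : measurable [set x | cell_count j x = i].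
Proof.
apply: measurable_nat_fiber_sum => t l.
case: (a j <= t%:R * h < a j.+1).
  by under eq_set do rewrite mul1n; exact: measurable_exceed.
under eq_set do rewrite mul0n.
have [->|l0] := eqVneq l 0%N.
  by rewrite (_ : mkset _ = setT)//; apply/seteqP; split.
by rewrite (_ : mkset _ = set0)//; apply/seteqP; split => // x /= /esym/eqP;
  rewrite (negbTE l0).
Qed.

Definition cells_event (kap : nat -> nat) : set T :=
  [set x | forall j, (j < r)%N -> cell_count j x = kap j].

Lemma measurable_cells_event kap : measurable (cells_event kap).
Proof.
rewrite (_ : cells_event kap = \bigcap_j
  (if (j < r)%N then [set x | cell_count j x = kap j] else setT)).
  apply: bigcap_measurable => // j _; case: ifP => // _.
  exact: measurable_cell_count.
apply/seteqP; split => x H j.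
  by move=> _; case: ifP => // /H.
by move=> jr; have := H j I; rewrite jr.
Qed.

Lemma cells_event_block kap :
  `|pr P (cells_event kap) - pr P (block_event exceed 0 (cell_blocks a r h
    kap))|
    <= h.
Proof.
rewrite -(pr_block_event u mf mphi Pinv 1); apply: pr_near.
- exact: measurable_cells_event.
- exact: measurable_Ek.
- exact: measurable_U.
move=> x Ux; have := @block_event_cells _ exceed 1 r (fun j => k j) kap x.
rewrite a0 cell_index0 addn0 => ->; last by move=> j _; exact: le_cell_index.
by split=> H j jr; have := H j jr; rewrite cell_count_block.
Qed.

Lemma sum_cell_count_le x :
  (\sum_(j < r) cell_count j x <= \sum_(0 <= t < (k r).+1) exceed t x)%N.
Proof.
rewrite exchange_big/=; apply: leq_sum => t _.
rewrite -big_distrl/= cells_partition ?mulr_ge0// 1?ltW//.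
by case: (_ < _); rewrite ?mul1n ?mul0n.
Qed.

(** Markov's inequality for a sum of indicators, by splitting [B] at the last time: where it
    exceeds, one point fewer is required of the earlier times. *)
Lemma pr_sum_exceed_ge n (K : nat) (B : set T) : measurable B ->
  (forall x, B x -> K <= \sum_(0 <= t < n) exceed t x)%N ->
  K%:R * pr P B <= \sum_(0 <= t < n) pr P (B `&` iter t f @^-1` U phi u).
Proof.
have mU t : measurable (iter t f @^-1` U phi u).
  by apply: measurable_preimage_iter => //; exact: measurable_U.
elim: n K B => [|n IH] K B mB BK.
  rewrite big_geq//; case: K BK => [|K] BK; first by rewrite mul0r.
  rewrite (_ : B = set0) ?pr0 ?mulr0//; apply/seteqP; split => // x /BK.
  by rewrite big_geq.
have mBI := measurableI _ _ mB (mU n); have mBD := measurableD mB (mU n).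
rewrite big_nat_recr//= (pr_setID P mB (mU n)) mulrDr.
have E t : pr P (B `&` iter t f @^-1` U phi u) =
    pr P (B `&` iter n f @^-1` U phi u `&` iter t f @^-1` U phi u) +
    pr P ((B `\` iter n f @^-1` U phi u) `&` iter t f @^-1` U phi u).
  rewrite (pr_setID P (measurableI _ _ mB (mU t)) (mU n)).
  congr (pr P _ + pr P _); first by rewrite setIAC.
  by apply/seteqP; split => x [[? ?] ?]; split => //; split.
under eq_bigr do rewrite E.
rewrite big_split/= addrAC; apply: lerD; last first.
  apply: IH => // x [Bx /(exceedN f phi u n) nx].
  by have := BK x Bx; rewrite big_nat_recr//= nx addn0.
have := IH K.-1 _ mBI; rewrite -lerBlDr => H.
apply: le_trans (H _).
  by rewrite -{2}[pr P _]mul1r -mulrBl ler_wpM2r ?pr_ge0// lerBlDr natr1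
    ler_nat leqSpred.
move=> x [Bx /(exceedE f phi u n) nx].
by have := BK x Bx; rewrite big_nat_recr//= nx; lia.
Qed.

Definition box (K : nat) : seq (r.-tuple nat) :=
  [seq map_tuple val e | e <- enum {: r.-tuple 'I_K}].

Lemma box_uniq K : uniq (box K).
Proof.
rewrite map_inj_uniq ?enum_uniq// => e e' /(congr1 val)/= /inj_map H.
by apply: val_inj; apply: H; exact: val_inj.
Qed.

(** [cell_index h (a r) + 1] times are involved, each exceeding with probability [h], so the mean
    number of points is at most [a r + h <= a r + 1], uniformly in the level. If fewer than [K]
    points occur, every cell count is below [K]. *)
Lemma cells_event_box (K : nat) : (0 < K)%N ->
  1 - (a r + 1) / K%:R <= \sum_(e <- box K) pr P (cells_event (nth 0%N e)).
Proof.
move=> K0; pose B := [set x | (K <= \sum_(0 <= t < (k r).+1) exceed t x)%N].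
have mB : measurable B.
  rewrite (_ : B = ~` \bigcup_(i in [set i | (i < K)%N])
     [set x | \sum_(0 <= t < (k r).+1) exceed t x = i]%N).
    apply: measurableC; apply: bigcup_measurable => i _.
    by apply: measurable_nat_fiber_sum => t j; exact: measurable_exceed.
  apply/seteqP; split => x.
    by move=> Bx [i /= iK E]; move: Bx; rewrite /B /= E leqNgt iK.
  move=> nB; rewrite /B /= leqNgt; apply/negP => lt; apply: nB.
  by exists (\sum_(0 <= t < (k r).+1) exceed t x)%N.
have mU t : measurable (iter t f @^-1` U phi u).
  by apply: measurable_preimage_iter => //; exact: measurable_U.
have PB : pr P B <= (a r + 1) / K%:R.
  rewrite ler_pdivlMr ?ltr0n// mulrC.
  apply: le_trans (@pr_sum_exceed_ge (k r).+1 K B mB _) _ => //.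
  apply: le_trans (_ : \sum_(0 <= t < (k r).+1) h <= _).
    apply: ler_sum => t _; rewrite -(pr_preimage_iter mf Pinv t (measurable_U u
      mphi)).
    by apply: le_pr (measurableI _ _ mB (mU t)) (mU t) _ => x [].
  rewrite sumr_const_nat subn0 -[_ *+ _]mulr_natl -natr1 mulrDl mul1r lerD//.
    by rewrite -ler_pdivlMr//; exact: cell_index_le.
  exact: pr_le1 (measurable_U u mphi).
rewrite lerBlDr; apply: le_trans (lerD (lexx _) PB).
apply: le_trans (lerD (pr_bigcup_le P (box K) (fun e =>
  measurable_cells_event (nth 0%N (e : r.-tuple nat)))) (lexx _)).
have mC : measurable (\bigcup_(e in [set` box K]) cells_event (nth 0%N (e :
  r.-tuple nat))).
  by apply: fin_bigcup_measurable => // e _; exact: measurable_cells_event.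
apply: le_trans (pr_setU_le P mC mB).
rewrite -(prT P); apply: le_pr => //; first exact: measurableU.
move=> x _; have [Bx|nB] := pselect (B x); [by right|left].
have cK j : (j < r)%N -> (cell_count j x < K)%N.
  move=> jr; rewrite ltnNge; apply/negP => Kj; apply: nB.
  apply: leq_trans (sum_cell_count_le x); apply: leq_trans Kj _.
  by rewrite (bigD1 (Ordinal jr))//= leq_addr.
pose e := [tuple Ordinal (cK j (ltn_ord j)) | j < r].
exists (map_tuple val e).
  by rewrite /= map_f// mem_enum.
move=> j jr /=; rewrite (nth_map (Ordinal (cK j jr))) ?size_tuple ?card_ord//.
have -> : nth (Ordinal (cK j jr)) e j = tnth e (Ordinal jr) by rewrite
  (tnth_nth (Ordinal (cK j jr))).
by rewrite tnth_mktuple.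
Qed.

End exceedance_cells.

(** R1 and R2 speak of levels close to the maximum, the other conditions of the levels [u n]. Just
    below the maximum [P(U v)] is nonzero, whereas [P(U (u n)) -> 0], so monotonicity of [U] drives
    [u n] up to the maximum; positivity of [P(U (u n))] keeps it strictly below. *)
Lemma cvg_below_max (R : realType) (d : measure_display) (T : measurableType d)
    (P : probability T R) (phi : T -> \bar R) (z : T) (tau : R) (u : nat -> R) :
  measurable_fun setT phi -> (forall x, (phi x <= phi z)%E) ->
  (\forall v \near below (phi z), pr P (U phi v) != 0) ->
  0 < tau -> n%:R * pr P (U phi (u n)%:E) @[n --> \oo] --> tau ->
  (u n)%:E @[n --> \oo] --> below (phi z).
Proof.
move=> mphi phi_max Upos tau0 ulev.
have hpos := level_gt0 tau0 ulev; have h0 := cvg_level mphi ulev.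
have lt_max : \forall n \near \oo, ((u n)%:E < phi z)%E.
  apply: filterS hpos => n; apply: contraTT; rewrite -leNgt => le.
  rewrite (_ : U phi (u n)%:E = set0) ?pr0 ?ltxx//.
  apply/seteqP; split => // x; rewrite /U /= ltNge.
  by rewrite (le_trans (phi_max x) le).
have above c v : (c < v)%E -> (v < phi z)%E -> pr P (U phi v) != 0 ->
    \forall n \near \oo, (c < (u n)%:E)%E.
  move=> cv vz v0; have : \forall n \near \oo, pr P (U phi (u n)%:E) < pr P (U
    phi v).
    by apply: (cvgr_lt _ h0); rewrite lt_neqAle eq_sym v0 pr_ge0.
  apply: filterS => n; apply: contraTT; rewrite -!leNgt => uc.
  apply: le_pr; [exact: measurable_U|exact: measurable_U|].
  by move=> x; rewrite /U /=; apply: le_lt_trans; apply: le_trans uc _;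
    exact: ltW.
move=> V; rewrite /below /within /=.
case E : (phi z) lt_max above Upos => [l| |] lt_max above.
- move=> Upos HV.
  have {}Upos : nbhs l (fun v : R => (v%:E < l%:E)%E -> pr P (U phi v%:E) != 0)
    := Upos.
  have {}HV : nbhs l (fun v : R => (v%:E < l%:E)%E -> V v%:E) := HV.
  move: Upos HV => /nbhs_ballP[e /= e0 Upos] /nbhs_ballP[e' /= e'0 HV].
  pose m := Num.min e e'; have m0 : 0 < m by rewrite lt_min e0 e'0.
  have me : m <= e by rewrite ge_min lexx.
  have me' : m <= e' by rewrite ge_min lexx orbT.
  have ab : \forall n \near \oo, ((l - m)%:E < (u n)%:E)%E.
    (* A level strictly between [l - m] and the maximum, still in the range where the probability is
       nonzero. *)
    apply: (above _ (l - m / 2)%:E); rewrite ?lte_fin; [lra|lra|].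
    apply: Upos; rewrite ?lte_fin; last lra.
    by rewrite /ball /= opprB addrC subrK ger0_norm; lra.
  change (\forall n \near \oo, V (u n)%:E).
  near=> n; have un : ((l - m)%:E < (u n)%:E)%E by near: n.
  have ul : ((u n)%:E < l%:E)%E by near: n.
  apply: HV => //; rewrite !lte_fin in un ul.
  by rewrite /ball /= ger0_norm; lra.
- move=> [M [_ HM]] [M' [_ HM']].
  have ab : \forall n \near \oo, (M'%:E < (u n)%:E)%E.
    have m1 : M <= Num.max M M' by rewrite le_max lexx.
    have m2 : M' <= Num.max M M' by rewrite le_max lexx orbT.
    apply: (above _ (Num.max M M' + 1)%:E); rewrite ?ltry ?lte_fin//; first lra.
    by apply: HM; rewrite /= ?ltry// lte_fin; lra.
  change (\forall n \near \oo, V (u n)%:E).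
  near=> n; apply: HM'; last by rewrite ltry.
  by near: n.
(* A maximum equal to [-oo] is impossible: no real level lies below it. *)
- move=> _ _; change (\forall n \near \oo, V (u n)%:E); move: lt_max;
  apply: filterS => n.
  by rewrite ltNge leNye.
Unshelve. all: by end_near.
Qed.

Lemma nested_Ukappa (R : realType) (d : measure_display) (T : measurableType d)
  (f : T -> T) (phi : T -> \bar R)
  p i v : nested f phi p i v = Ukappa f phi p i v.
Proof.
apply/seteqP; split => x.
  by move=> H; apply/UkappaP => j ji; exact: H.
by move=> /UkappaP H j ji; exact: H.
Qed.

(** R1 and R2 enter through their consequences along [u n]: no early return, and the masses of
    [Ukappa]. The comparison runs from the true cell counts through the shifted blocks and the
    renewal recursion to [limit_event]. *)
Lemma REPP_cvg (R : realType) (d : measure_display) (T : measurableType d)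
    (P : probability T R) (f : T -> T) (phi : T -> \bar R) (p : nat)
    (theta tau : R) (u : nat -> R) (t : nat -> nat) :
  measurable_fun setT f -> measurable_fun setT phi ->
  (forall A, measurable A -> P (f @^-1` A) = P A) ->
  0 < theta < 1 -> (0 < p)%N ->
  (\forall n \near \oo, forall i x, (0 < i < p)%N ->
    U phi (u n)%:E x -> ~ U phi (u n)%:E (iter i f x)) ->
  (forall k, pr P (Ukappa f phi p k (u n)%:E) /
    ((1 - theta) ^+ k * pr P (U phi (u n)%:E)) @[n --> \oo] --> (1 : R)) ->
  0 < tau -> n%:R * pr P (U phi (u n)%:E) @[n --> \oo] --> tau ->
  condition_Dp P f phi p u t -> condition_Dp' P f phi p u t ->
  forall (d' : measure_display) (O : measurableType d') (PO : probability O R)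
    (N : set R -> O -> \bar R),
  compound_poisson PO theta (geometric_pmf theta) N ->
  cvg_in_distribution P PO (REPP P f phi u) N.
Proof.
move=> mf mphi Pinv theta01 p_gt0 no_return pr_asymp tau_gt0 u_level Dp Dp'.
move=> dO O PO N cpN.
have [W [D [[indepW indepD] indepWD lawW lawD NE]]] := cpN.
move=> m J ringJ g gcont [B gB].
have [r [a [a0 a_nd aJ]]] := ring_adapted ringJ.
pose h n := pr P (U phi (u n)%:E).
have h_pos : \forall n \near \oo, 0 < h n by exact: level_gt0 tau_gt0 u_level.
have h0 : h n @[n --> \oo] --> 0 by exact: cvg_level mphi u_level.
(* The atoms on both probability spaces are indexed by the tuple of cell counts, and [F] is the
   common value of the test function there. *)
pose F (e : r.-tuple nat) : R :=
  g (\row_l (\sum_(j < r) (a j \in J l) * nth 0%N e j)%N%:R).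
have REPPE n x l : 0 < h n -> fine (REPP P f phi u n (J l) x) =
    (\sum_(j < r) (a j \in J l) * cell_count P f phi (u n)%:E a r j x)%N%:R.
  move=> hn; have E := @count_exceed_cells R _ T P f phi _ a r a0 a_nd hn _ x
    (aJ l).
  exact: (congr1 fine E).
have mJ l : measurable (J l) by exact: ringR_measurable.
have tupleP (e e' : r.-tuple nat) :
    (forall j, (j < r)%N -> nth 0%N e j = nth 0%N e' j) -> e = e'.
  move=> H; apply: val_inj; apply: (@eq_from_nth _ 0%N); rewrite !size_tuple//.
apply: (@cvg_expectation _ _ _ _ _ _ _ (r.-tuple nat)
  (fun n e => cells_event P f phi (u n)%:E a r (nth 0%N e))
  (fun e => limit_event W D a r (nth 0%N e)) F _ _ B).
- by move=> n e; exact: measurable_cells_event.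
- by move=> e; exact: measurable_limit_event.
- by move=> n e e' x H H'; apply: tupleP => j jr; rewrite -(H j jr) -(H' j jr).
- by move=> e e' w H H'; apply: tupleP => j jr;
  exact: limit_event_inj H H' _ jr.
- move=> e.
  have H1 := block_event_asymp mf mphi Pinv theta01 p_gt0 no_return pr_asymp
    tau_gt0 u_level Dp Dp' r (nth 0%N e) a0 a_nd.
  have H2 := cvg_renewal_prob indepW indepD indepWD lawW lawD erefl
    a0 a_nd (kap := nth 0%N e) h_pos h0 (r := r).
  pose x n := pr P (block_event (exceed f phi (u n)%:E) 0
      (cell_blocks a r (h n) (nth 0%N e))).
  have H : x n @[n --> \oo] --> pr PO (limit_event W D a r (nth 0%N e)).
    exact: (cvg_sub0 H1 H2).
  pose y n := pr P (cells_event P f phi (u n)%:E a r (nth 0%N e)).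
  have yx : y n - x n @[n --> \oo] --> (0 : R).
    apply: (@squeeze_cvgr _ _ _ _ (fun n => - h n) h) => //; last first.
      by rewrite -oppr0; exact: cvgN.
    near=> n; have hn : 0 < h n by near: n.
    by rewrite -ler_norml; apply: cells_event_block.
  exact: (cvg_sub0 yx H).
(* [K] is chosen so that Markov's bound [(a r + 1) / K] is at most [eps]. *)
- move=> eps eps0; pose K := (Num.truncn ((a r + 1) / eps)).+1.
  exists (box r K); first exact: box_uniq.
  near=> n; have hn : 0 < h n by near: n.
  apply: le_trans (cells_event_box mf mphi Pinv r a0 a_nd hn (ltn0Sn _)).
  rewrite lerD2l lerN2 ler_pdivrMr// mulrC -ler_pdivrMr//.
  exact/ltW/truncnS_gt.
- near=> n; have hn : 0 < h n by near: n.
  pose Y x : r.-tuple nat := [tuple cell_count P f phi (u n)%:E a r j x | j <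
    r].
  have YE x j (jr : (j < r)%N) : nth 0%N (Y x) j = cell_count P f phi (u n)%:E
    a r j x.
    have -> : nth 0%N (Y x) j = tnth (Y x) (Ordinal jr) by rewrite (tnth_nth
      0%N).
    by rewrite tnth_mktuple.
  have GF x : g (\row_l fine (REPP P f phi u n (J l) x)) = F (Y x).
    rewrite /F; congr g; apply/rowP => l; rewrite !mxE REPPE//.
    by congr (_%:R); apply: eq_bigr => j _; rewrite YE.
  split.
    rewrite (_ : (fun x => _) = F \o Y); last by apply/funext => x; exact: GF.
    apply: measurable_countable_comp => e.
    rewrite (_ : _ @^-1` _ = cells_event P f phi (u n)%:E a r (nth 0%N e)).
      exact: measurable_cells_event.
    apply/seteqP; split => x /=; first by move=> <- j jr; rewrite YE.
    by move=> H; apply: tupleP => j jr; rewrite YE// H.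
  move=> e x Hx; rewrite GF; congr F; apply: tupleP => j jr.
  by rewrite YE// Hx.
- by move=> n x; exact: gB.
- exact: (measurable_count_fun NE g mJ).
- move=> e w Hw; rewrite /F; congr g; apply/rowP => l; rewrite !mxE.
  by rewrite (count_limit_event NE a0 a_nd (mJ l) (aJ l) Hw).
- by move=> w; exact: gB.
Unshelve. all: by end_near.
Qed.

Theorem theorem1 (R : realType) (d : nat) (X : ptopologicalType)
    (M : riemannian_manifold R d X)
    (P : probability (borel X) R)
    (f : X -> X) (phi : X -> \bar R) (zeta : X) (p : nat)
    (theta tau : R) (u : nat -> R) (t : nat -> nat)
    (mf : measurable_fun [set: borel X] (f : borel X -> borel X))
    (mphi : measurable_fun [set: borel X] (phi : borel X -> \bar R))
    (Pinv : forall A : set (borel X), measurable A -> P (f @^-1` A) = P A)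
    (phi_max : forall x, (phi x <= phi zeta)%E)
    (zeta_periodic : prime_period f zeta p)
    (R1 : condition_R1 d P f phi zeta p)
    (R2 : condition_R2 d P f phi zeta p theta)
    (tau_gt0 : 0 < tau)
    (u_level : n%:R * fine (P (U phi (u n)%:E)) @[n --> \oo] --> tau)
    (Dp : condition_Dp P f phi p u t)
    (Dp' : condition_Dp' P f phi p u t)
    (dO : measure_display) (O : measurableType dO) (PO : probability O R)
    (N : set R -> O -> \bar R)
    (cpN : compound_poisson PO theta (geometric_pmf theta) N) :
  cvg_in_distribution P PO (REPP P f phi u) N.
Proof.
have [p0 _ _] := zeta_periodic; have [_ _ _ R1'] := R1.
have [theta01 _ asymp] := R2.
have Fbelow : Filter (below (phi zeta)) by exact: within_filter.
(* R2 with [i = 0]: where [P(U v) = 0] the quotient is 0 by the convention on division, yet it tends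
   to 1. *)
have Upos : \forall v \near below (phi zeta), pr P (U phi v) != 0.
  have H : \forall v \near below (phi zeta), 0 <
      fine (P (nested f phi p 0 v)) / ((1 - theta) ^+ 0 * fine (P (U phi v))).
    exact: (cvgr_gt _ (asymp 0%N)).
  apply: (@filterS _ (below (phi zeta)) Fbelow _ _ _ H) => v.
  apply: contraTneq => v0.
  by rewrite -/(pr P (U phi v)) v0 mulr0 invr0 mulr0 ltxx.
have ubelow := cvg_below_max mphi phi_max Upos tau_gt0 u_level.
have no_return : \forall n \near \oo, forall i x, (0 < i < p)%N ->
    U phi (u n)%:E x -> ~ U phi (u n)%:E (iter i f x).
  have H : \forall n \near \oo, forall j, (1 <= j <= p - 1)%N ->
    U phi (u n)%:E `&` (iter j f @^-1` U phi (u n)%:E) = set0 := ubelow _ R1'.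
  apply: filterS H => n H i x /andP[i0 ip] Ux Ui.
  have : (U phi (u n)%:E `&` iter i f @^-1` U phi (u n)%:E) x by [].
  by rewrite H// i0 -ltnS subn1 prednK.
have pr_asymp k : pr P (Ukappa f phi p k (u n)%:E) /
    ((1 - theta) ^+ k * pr P (U phi (u n)%:E)) @[n --> \oo] --> (1 : R).
  have H := cvg_comp _ _ ubelow (asymp k).
  rewrite (_ : (fun n => _) = (fun n => fine (P (nested f phi p k (u n)%:E)) /
    ((1 - theta) ^+ k * fine (P (U phi (u n)%:E))))); first exact: H.
  by apply/funext => n; rewrite (@nested_Ukappa R _ (borel X)).
exact: (@REPP_cvg _ _ (borel X) P f phi p theta tau u t).
Qed.
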